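(* Let $X$ be an orientable nondegenerate weakly self-dual manifold of rank $2$ and let $p\in X$. Regard $\mathcal{L}_{\mathbb{C}}$ (the complex Lie algebra generated by $L_j,V_j,\Lambda_j,A_j$, $j=0,1,2$) and $J$ as acting on $\bigwedge^*T^*_pX\otimes\mathbb{C}$. Then the Lie algebra $\mathcal{L}_{\mathbb{C}}\oplus\langle J\rangle$ equals the Lie algebra of quadratic invariants, i.e. of the elements of $\mathcal{C}^2_p\otimes\mathbb{C}$ that commute with $J$.
   Context: A weakly self-dual (WSD) manifold of rank $m$ is a smooth manifold $X$ with a Riemannian metric and closed smooth $2$-forms $\omega_1,\omega_2,\omega_D$ such that the distribution $\omega_1^0+\omega_2^0$ is integrable (where $\omega^0$ is the set of tangent vectors contracting to zero with $\omega$) and at each $p\in X$ there is an orthogonal basis $dx_1,\dots,dx_m,dy^1_1,\dots,dy^1_m,dy^2_1,\dots,dy^2_m,dz_1,\dots,dz_c,dw_1,\dots,dw_c$ of $T^*_pX$, whose $dx_i,dy^1_i,dy^2_i$ are orthonormal, with $\omega_1=\sum_i dx_i\wedge dy^1_i$, $\omega_2=\sum_i dx_i\wedge dy^2_i$, $\omega_D=\sum_i dy^1_i\wedge dy^2_i+\sum_i dz_i\wedge dw_i$ at $p$. It is nondegenerate if $\omega_1^0\cap\omega_2^0=0$ at all points (i.e. $c=0$, $\dim X=3m$). For $X$ orientable (with a fixed orientation), nondegenerate and of rank $2$ ($\dim X=6$), write, at each point, $v_{i0}=dx_i$, $v_{i1}=dy^1_i$, $v_{i2}=dy^2_i$ ($i=1,2$),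 an orthonormal adapted coframe, so that $\omega_1=v_{10}\wedge v_{11}+v_{20}\wedge v_{21}$, $\omega_2=v_{10}\wedge v_{12}+v_{20}\wedge v_{22}$, $\omega_D=v_{11}\wedge v_{12}+v_{21}\wedge v_{22}$. The planes $W_j=\langle v_{1j},v_{2j}\rangle$ are canonical and canonically identified with each other by $v_{i0}\leftrightarrow v_{i1}\leftrightarrow v_{i2}$; the orientation of $X$ orients them compatibly, and adapted coframes are always chosen oriented, hence unique up to a simultaneous rotation in $\mathbf{SO}(2,\mathbb{R})$ of the three planes. The following operators on forms do not depend on the chosen coframe: $L_0(\phi)=\omega_D\wedge\phi$, $L_1(\phi)=-\omega_2\wedge\phi$, $L_2(\phi)=\omega_1\wedge\phi$; $V_j(\phi)=v_{1j}\wedge v_{2j}\wedge\phi$ for $j=0,1,2$; $\Lambda_j=L_j^*$ and $A_j=V_j^*$ are the pointwise adjoints with respect to the metric; $J$ is the derivation of $\bigwedge^*T^*X$ of degree $0$ with $J(v_{1j})=v_{2j}$, $J(v_{2j})=-v_{1j}$. $\mathcal{L}$ is the real Lie algebra generated by $L_j,V_j,\Lambda_j,A_j$, $j=0,1,2$, and $\mathcal{L}_{\mathbb{C}}=\mathcal{L}\otimes\mathbb{C}$; its elements act fibrewise on $\bigwedge^*T^*X\otimes\mathbb{C}$. $\mathcal{C}_p$ is the real Clifford algebra of $T_pX\oplus T^*_pX$ with relations $\phi\psi+\psi\phi=-2\langle\phi,\psi\rangle$, where $T_pX$ and $T_p^*X$ are isotropic and $\langle v_{ij},\partial/\partial v_{hk}\rangle=-\frac12\delta_{ih}\delta_{jk}$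 ($\{\partial/\partial v_{ij}\}$ is the basis of $T_pX$ dual to $\{v_{ij}\}$). It is identified with its faithful image in $\mathrm{End}_{\mathbb{R}}(\bigwedge^*T^*_pX)$ under $v_{ij}\mapsto E_{ij}$ (wedge with $v_{ij}$ on the left), $\partial/\partial v_{ij}\mapsto I_{ij}$ (contraction with $\partial/\partial v_{ij}$). $\mathcal{C}^2_p\subset\mathcal{C}_p$ is the image of the natural map $\bigwedge^2(T_pX\oplus T^*_pX)\to\mathcal{C}_p$, $u\wedge v\mapsto\frac12(uv-vu)$; it is a Lie subalgebra under the commutator. *)

(* Defs.v *)
From HB Require Import structures.
From mathcomp Require Import all_boot all_order all_algebra.
From mathcomp Require Import all_classical all_reals all_analysis.
From mathcomp Require Import complex.
Set Implicit Arguments.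
Unset Strict Implicit.
Unset Printing Implicit Defensive.
Import Order.TTheory GRing.Theory Num.Theory.
Import numFieldNormedType.Exports.
Local Open Scope classical_set_scope.
Local Open Scope ring_scope.
Local Open Scope complex_scope.

Section Smooth.
Variables (R : realType) (n : nat).
Implicit Types (f : 'rV[R]_n -> R) (U : set 'rV[R]_n).

Definition partial (i : 'I_n) f : 'rV[R]_n -> R := fun y => 'D_(delta_mx 0 i) f y.

Fixpoint Ck_on (k : nat) U f : Prop :=
  (forall y, U y -> {for y, continuous f}) /\
  (if k is k'.+1 then
     forall i, (forall y, U y -> derivable f y (delta_mx 0 i)) /\
               Ck_on k' U (partial i f)
   else True).

Definition smooth_on U f := forall k, Ck_on k U f.

End Smooth.

(* [chart] indexes an atlas: chart [a] is the homeomorphism [crd a], with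
   inverse [crdV a], from the open set [chart_dom a] onto an open set of R^n. *)
Record smooth_manifold (R : realType) (n : nat) (X : topologicalType) := {
  chart : Type;
  chart_dom : chart -> set X;
  crd : chart -> X -> 'rV[R]_n;
  crdV : chart -> 'rV[R]_n -> X;
  X_hausdorff : hausdorff_space X;
  X_second_countable : @second_countable X;
  chart_dom_open : forall a, open (chart_dom a);
  chart_dom_cover : forall p, exists a, chart_dom a p;
  crd_open : forall a, open (crd a @` chart_dom a);
  crdK : forall a p, chart_dom a p -> crdV a (crd a p) = p;
  crd_continuous : forall a p, chart_dom a p -> {for p, continuous (crd a)};
  crdV_continuous : forall a y, (crd a @` chart_dom a) y -> {for y, continuous (crdV a)};
  transition_smooth : forall a b (j : 'I_n),
    smooth_on (crd a @` (chart_dom a `&` chart_dom b)) (fun y => crd b (crdV a y) 0 j)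
}.

Section Tensors.
Variables (R : realType) (n : nat) (X : topologicalType).
Variable M : smooth_manifold R n X.

(* In the chart [a], a tangent vector at [p] is the row vector of its components
   in the basis d/dx_i, and a covector that of its components in the dual basis
   dx_i.  Entry (i, j) of [jac a b p] is the derivative of the j-th coordinate
   of [b] along the i-th one of [a], so tangent vectors transform by
   u |-> u *m jac a b p. *)
Definition jac (a b : chart M) (p : X) : 'M[R]_n :=
  \matrix_(i, j) partial i (fun y => crd b (crdV a y) 0 j) (crd a p).

(* Smooth covariant tensor fields of order 2: entry (i, j) of [T a p] is
   T(d/dx_i, d/dx_j). *)
Record tensor2 := {
  tensor2_val :> chart M -> X -> 'M[R]_n;
  tensor2_smooth : forall a i j,
    smooth_on (crd a @` chart_dom a) (fun y => tensor2_val a (crdV a y) i j);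
  tensor2_transform : forall a b p, chart_dom a p -> chart_dom b p ->
    tensor2_val a p = jac a b p *m tensor2_val b p *m (jac a b p)^T
}.

Definition is_metric (g : tensor2) := forall a p, chart_dom a p ->
  (g a p)^T = g a p /\ forall u : 'rV[R]_n, u != 0 -> 0 < (u *m g a p *m u^T) 0 0.

Definition is_2form (w : tensor2) := forall a p, chart_dom a p -> (w a p)^T = - w a p.

Definition is_closed_2form (w : tensor2) := is_2form w /\
  forall a p, chart_dom a p -> forall i j k : 'I_n,
    let d l r s := partial l (fun y => w a (crdV a y) r s) (crd a p) in
    d i j k + d j k i + d k i j = 0.

(* A distribution is given, in each chart, by matrices whose row spaces are its
   fibres.  It is integrable if it is locally tangent to the level sets of a
   submersion f = (f_1, ..., f_r). *)
Definition integrable_distribution (D : chart M -> X -> 'M[R]_n) :=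
  forall a p, chart_dom a p ->
  exists (r : nat) (f : 'I_r -> 'rV[R]_n -> R) (U : set 'rV[R]_n),
    [/\ open U, U (crd a p), U `<=` crd a @` chart_dom a,
        forall k, smooth_on U (f k) &
        forall y, U y -> let df := \matrix_(i, k) partial i (f k) y in
          \rank df = r /\ (D a (crdV a y) == kermx df)%MS].

(* [orient a p] is 1 or -1 according to whether the coordinates of [a] are
   positively oriented at [p]. *)
Record orientation := {
  orient :> chart M -> X -> R;
  orient_pm1 : forall a p, chart_dom a p -> orient a p = 1 \/ orient a p = -1;
  orient_locally_constant : forall a p, chart_dom a p ->
    \forall q \near p, orient a q = orient a p;
  orient_transform : forall a b p, chart_dom a p -> chart_dom b p ->
    orient a p = Num.sg (\det (jac a b p)) * orient b p
}.

End Tensors.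

Section CoframeAtAPoint.
Variables (R : realType) (n : nat).
Implicit Types (g w : 'M[R]_n) (u v : 'rV[R]_n).

Definition codot g u v : R := (u *m invmx g *m v^T) 0 0.

Definition wedge2 u v : 'M[R]_n := u^T *m v - v^T *m u.

Definition adapted_coframe m c g w1 w2 wD
    (dx dy1 dy2 : 'I_m -> 'rV[R]_n) (dz dw : 'I_c -> 'rV[R]_n) :=
  let unit_part := codom dx ++ codom dy1 ++ codom dy2 in
  let coframe := unit_part ++ codom dz ++ codom dw in
  [/\ basis_of fullv coframe,
      pairwise (fun u v => codot g u v == 0) coframe,
      all (fun u => codot g u u == 1) unit_part &
      [/\ w1 = \sum_i wedge2 (dx i) (dy1 i),
          w2 = \sum_i wedge2 (dx i) (dy2 i) &
          wD = \sum_i wedge2 (dy1 i) (dy2 i) + \sum_i wedge2 (dz i) (dw i)]].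

End CoframeAtAPoint.

Record wsd_structure (R : realType) (n : nat) (X : topologicalType)
    (M : smooth_manifold R n X) (m : nat) := {
  metric : tensor2 M;
  omega1 : tensor2 M;
  omega2 : tensor2 M;
  omegaD : tensor2 M;
  metricP : is_metric metric;
  omega1_closed : is_closed_2form omega1;
  omega2_closed : is_closed_2form omega2;
  omegaD_closed : is_closed_2form omegaD;
  wsd_integrable : integrable_distribution
    (fun a p => (kermx (omega1 a p) + kermx (omega2 a p))%MS);
  wsd_coframe : forall a p, chart_dom a p -> exists c dx dy1 dy2 dz dw,
    @adapted_coframe R n m c (metric a p) (omega1 a p) (omega2 a p) (omegaD a p)
      dx dy1 dy2 dz dw
}.

Definition wsd_nondegenerate R n X (M : smooth_manifold R n X) m
    (W : wsd_structure M m) :=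
  forall a p, chart_dom a p ->
    (kermx (omega1 W a p) :&: kermx (omega2 W a p))%MS = 0.

(* The exterior algebra over F on generators e_i, i : 'I_n, by coordinates in
   the basis e_S = e_i1 /\ ... /\ e_ik for S = {i1 < ... < ik}. *)
Notation ext F n := {ffun {set 'I_n} -> F^o}.

Section Exterior.
Variables (F : fieldType) (n : nat).
Implicit Types (phi psi : ext F n) (S T : {set 'I_n}).

(* For disjoint S and T, e_S /\ e_T = ext_sign S T *: e_(S :|: T). *)
Definition ext_sign S T : F :=
  (-1) ^+ #|[set st : 'I_n * 'I_n | [&& st.1 \in S, st.2 \in T & (st.2 < st.1)%N]]%SET|.

Definition wedge phi psi : ext F n :=
  [ffun S : {set 'I_n} => \sum_(T : {set 'I_n} | T \subset S)
     ext_sign T (S :\: T)%SET * phi T * psi (S :\: T)%SET].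

Definition form1 (u : 'rV[F]_n) : ext F n :=
  [ffun S : {set 'I_n} => \sum_(i | S == [set i]%SET) u 0 i].

Definition form2 (w : 'M[F]_n) : ext F n :=
  [ffun S : {set 'I_n} =>
     \sum_(i : 'I_n) \sum_(j : 'I_n | (i < j)%N && (S == [set i; j]%SET)) w i j].

Definition homogeneous (k : nat) phi := forall S, phi S != 0 -> #|S| = k.

Definition wedgeL phi : 'End(ext F n) := linfun (wedge phi).

Definition contraction (u : 'rV[F]_n) : 'End(ext F n) :=
  linfun (fun phi : ext F n => [ffun S : {set 'I_n} =>
    \sum_(i | i \notin S) ext_sign [set i]%SET S * u 0 i * phi (i |: S)%SET] : ext F n).

(* The minor of A with rows S and columns T, when #|S| = #|T|; the default value
   of [nth] is never reached. *)
Definition set_minor (A : 'M[F]_n) S T : F :=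
  \det (\matrix_(i < #|S|, j < #|S|) A (enum_val i) (nth (enum_val i) (enum T) j)).

(* The inner product induced by the metric g of the tangent space: forms of
   different degrees are orthogonal and
   <u_1 /\ ... /\ u_k, v_1 /\ ... /\ v_k> = det (<u_i, v_j>) for covectors. *)
Definition ext_dot (g : 'M[F]_n) phi psi : F :=
  \sum_(S : {set 'I_n}) \sum_(T : {set 'I_n} | #|T| == #|S|)
    phi S * psi T * set_minor (invmx g) S T.

Definition adjoint (g : 'M[F]_n) (D : 'End(ext F n)) : 'End(ext F n) :=
  xget 0 [set D' : 'End(ext F n) |
    forall phi psi, ext_dot g (D phi) psi = ext_dot g phi (D' psi)].

Definition derivation (D : 'End(ext F n)) :=
  forall phi psi, D (wedge phi psi) = wedge (D phi) psi + wedge phi (D psi).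

Definition degree0 (D : 'End(ext F n)) :=
  forall k phi, homogeneous k phi -> homogeneous k (D phi).

End Exterior.

Definition lie_bracket (K : fieldType) (V : vectType K) (D E : 'End(V)) : 'End(V) :=
  (D \o E)%VF - (E \o D)%VF.

Definition lin_closed (K : fieldType) (V : vectType K) (U : set V) :=
  U 0 /\ forall c D E, U D -> U E -> U (c *: D + E).

Definition lie_closed (K : fieldType) (V : vectType K) (U : set 'End(V)) :=
  lin_closed U /\ forall D E, U D -> U E -> U (lie_bracket D E).

Definition lin_span (K : fieldType) (V : vectType K) (G : set V) : set V :=
  smallest (@lin_closed K V) G.

Definition lie_generated (K : fieldType) (V : vectType K) (G : set 'End(V)) :
    set 'End(V) :=
  smallest (@lie_closed K V) G.

Section Complexification.
Variables (R : realType) (n : nat).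

Definition cplx (D : 'End(ext R n)) : 'End(ext R[i] n) :=
  linfun (fun phi : ext R[i] n =>
    [ffun S => D [ffun T => complex.Re (phi T)] S +i*
               D [ffun T => complex.Im (phi T)] S] : ext R[i] n).

(* U (x) C for a real subspace U of End_R(ext R n), inside
   End_C(ext R[i] n) = End_R(ext R n) (x) C. *)
Definition complexified (U : set 'End(ext R n)) : set 'End(ext R[i] n) :=
  lin_span (cplx @` U).

(* A pair (t, u) of a tangent vector and a covector acts by contraction plus
   exterior multiplication; the square of this operator is the scalar u(t),
   as required by the Clifford relations with <t, u> = - u(t) / 2. *)
Definition clifford (t u : 'rV[R]_n) : 'End(ext R n) :=
  contraction t + wedgeL (form1 u).

Definition clifford2 : set 'End(ext R n) :=
  lin_span [set D | exists t u t' u',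
    D = 2^-1 *: lie_bracket (clifford t u) (clifford t' u')].

End Complexification.

Section Rank2.
Variables (R : realType) (n : nat) (X : topologicalType).
Variables (M : smooth_manifold R n X) (W : wsd_structure M 2) (o : orientation M).
Variables (a : chart M) (p : X).

(* v i j is the covector v_{i+1,j} of the usual numbering: dx, dy^1, dy^2 for
   j = 0, 1, 2.  The planes W_j = <v 0 j, v 1 j> are oriented so that X has the
   orientation of W_0 (+) W_1 (+) W_2. *)
Definition oriented_adapted_coframe (v : 'I_2 -> 'I_3 -> 'rV[R]_n) :=
  let plane j := wedge (form1 (v 0 j)) (form1 (v 1 j)) in
  @adapted_coframe R n 2 0 (metric W a p) (omega1 W a p) (omega2 W a p)
    (omegaD W a p) (v^~ 0) (v^~ 1) (v^~ 2) (fun=> 0) (fun=> 0) /\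
  0 < o a p * wedge (plane 0) (wedge (plane 1) (plane 2)) [set: 'I_n]%SET.

Definition opL (j : 'I_3) : 'End(ext R n) :=
  wedgeL (nth 0 [:: form2 (omegaD W a p);
                    - form2 (omega2 W a p);
                    form2 (omega1 W a p)] j).

Variable v : 'I_2 -> 'I_3 -> 'rV[R]_n.

Definition opV (j : 'I_3) : 'End(ext R n) :=
  wedgeL (wedge (form1 (v 0 j)) (form1 (v 1 j))).

Definition opLambda j := adjoint (metric W a p) (opL j).
Definition opA j := adjoint (metric W a p) (opV j).

Definition opJ : 'End(ext R n) :=
  xget 0 [set D | [/\ derivation D, degree0 D &
    forall j, D (form1 (v 0 j)) = form1 (v 1 j) /\
              D (form1 (v 1 j)) = - form1 (v 0 j)]].

Definition wsd_lie : set 'End(ext R n) :=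
  lie_generated (range opL `|` range opV `|` range opLambda `|` range opA).

Definition wsd_lieC : set 'End(ext R[i] n) := complexified wsd_lie.

Definition quadratic_invariants : set 'End(ext R[i] n) :=
  [set D | complexified (@clifford2 R n) D /\ lie_bracket D (cplx opJ) = 0].

End Rank2.

(* Main.v *)
Require Import Defs.
From HB Require Import structures.
From mathcomp Require Import all_boot all_order all_algebra.
From mathcomp Require Import all_classical all_reals all_analysis.
From mathcomp Require Import complex.
From mathcomp Require Import fintype finset ring.
Require Import Defs.

(** At the point p put V = T_p + T_p^*, let [clif x] be the operator by which
    x in V acts on forms, and let j be the endomorphism of V that rotates each
    plane spanned by v_1k and v_2k, and dually each plane of vectors, by a
    quarter turn.  The operator J is the unique element of the quadratic part of
    the Clifford algebra with [J, clif x] = clif (j x), so an element of C^2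
    commutes with J exactly when its adjoint action on V is j-linear.

    Everything descends to the reals.  An operator on complex forms is D + iE
    for unique real D and E, the condition [D + iE, J] = 0 separates, and so do
    the two sides of the claim ([complexified_decomposition]).

    The real invariants are spanned by
      H(x, y) = 1/2 [clif x, clif y] + 1/2 [clif (j x), clif (j y)],
    because (ad J)^2 sends Q = 1/2 [clif x, clif y] to
    2 (1/2 [clif (j x), clif (j y)] - Q): on ker (ad J) the identity coincides
    with Q |-> Q + 1/4 (ad J)^2 Q = 1/2 H(x, y)  ([invariant_hquad]).
    Write e_k for the covector v_1k and f_k for the dual vector.
    The generators of the Lie algebra are, up to scalars, the elements
    H(e_i, e_k), H(f_i, f_k), H(e_i, j e_i) and H(f_i, j f_i).  Brackets of
    H's follow from the action of H(x, y) on V ([bracket_hquad]), and they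
    produce every H(x, y) except that only the differences of the three
    H(j e_k, f_k) are obtained, as befits the splitting of gl(6) into sl(6) and
    scalars.  The sum of these three is J itself, so adding the line of J yields
    all the invariants ([hquad_in_extension]).

    Finally the sum is direct.  The functional D |-> tr (J D) kills brackets of
    operators commuting with J, and it equals a multiple of the Clifford form
    b (j x, y) on H(x, y) ([J_trace_hquad]); it therefore vanishes on the Lie
    algebra but not on J ([generated_multiple_of_J]).

    The adjoints among the generators are identified by the fact that wedging with
    u is adjoint to contraction with the metric dual of u ([ext_dot_ext_mul]), which
    is the Laplace expansion of the minors defining the inner product on forms. *)

Set Implicit Arguments.
Unset Strict Implicit.
Unset Printing Implicit Defensive.
Import Order.TTheory GRing.Theory Num.Theory.
Local Open Scope ring_scope.

(** * Functions known to be linear *)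

(** The maps sending a vector to an operator on forms are used through a proof of
    their linearity, so that rewriting never has to find a linear structure by
    unfolding such operators. *)
Section LinearPredicate.
Variables (K : pzRingType) (U V : lmodType K) (f : U -> V).
Hypothesis f_lin : linear f.

Let fl : {linear U -> V} := HB.pack f (GRing.isLinear.Build _ _ _ _ _ f_lin).

Lemma linear_map0 : f 0 = 0. Proof. exact: (linear0 fl). Qed.
Lemma linear_mapN x : f (- x) = - f x. Proof. exact: (linearN fl). Qed.
Lemma linear_mapD x y : f (x + y) = f x + f y. Proof. exact: (linearD fl). Qed.
Lemma linear_mapB x y : f (x - y) = f x - f y. Proof. exact: (linearB fl). Qed.
Lemma linear_mapZ c x : f (c *: x) = c *: f x.
Proof. by rewrite -[c *: x]addr0 f_lin linear_map0 addr0. Qed.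
Lemma linear_map_sum (I : finType) (x : I -> U) :
  f (\sum_i x i) = \sum_i f (x i).
Proof. exact: (linear_sum fl). Qed.

End LinearPredicate.

(** * Exterior multiplication and contraction in coordinates *)
Section ExteriorAlgebra.
Variables (F : fieldType) (n : nat).
Implicit Types (phi psi : ext F n) (S T : {set 'I_n}) (i j : 'I_n).
Implicit Types (u v t s : 'rV[F]_n).

Lemma ext_signE S T :
  ext_sign F S T = \prod_(s in S) \prod_(t in T) (-1) ^+ (t < s)%N.
Proof.
rewrite /ext_sign -sum1_card.
under [RHS]eq_bigr do rewrite prodrXr.
rewrite prodrXr pair_big_dep /=; congr (_ ^+ _).
rewrite [RHS](bigID (fun p : 'I_n * 'I_n => (p.2 < p.1)%N)) /=.
rewrite [X in (_ + X)%N]big1 ?addn0; last by move=> p /andP[_ /negPf ->].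
apply: eq_big => [p|p]; first by rewrite inE andbA.
by rewrite inE => /and3P[_ _ ->].
Qed.

(** The sign of e_i /\ e_S.  It counts the elements of S below i, so it is
    meaningful, and unchanged by inserting or removing i, even when i lies in S;
    the formulas for wedging with and contracting by a vector share it. *)
Definition ins_sign i S : F := ext_sign F [set i]%SET S.

Lemma ins_signE i S : ins_sign i S = \prod_(t in S) (-1) ^+ (t < i)%N.
Proof. by rewrite /ins_sign ext_signE big_set1. Qed.

Lemma ins_sign_sqr i S : ins_sign i S * ins_sign i S = 1.
Proof. by rewrite /ins_sign /ext_sign -expr2 -exprM mulnC exprM sqrrN !expr1n. Qed.

Lemma ins_signU1 i j S : j \notin S -> ins_sign i (j |: S)%SET = (-1) ^+ (j < i)%N * ins_sign i S.
Proof. by move=> jS; rewrite !ins_signE big_setU1. Qed.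

Lemma ins_signD1 i j S : j \in S -> ins_sign i (S :\ j)%SET = (-1) ^+ (j < i)%N * ins_sign i S.
Proof.
move=> jS; rewrite -{2}(setD1K jS) ins_signU1 ?setD11 //.
by rewrite mulrA -expr2 sqrr_sign mul1r.
Qed.

Lemma ins_signD1_same i S : ins_sign i (S :\ i)%SET = ins_sign i S.
Proof.
have [iS|iS] := boolP (i \in S); first by rewrite ins_signD1 // ltnn mul1r.
by rewrite (setDidPl _) // disjoint_sym disjoints1.
Qed.

Lemma ins_signU1_same i S : ins_sign i (i |: S)%SET = ins_sign i S.
Proof.
have [iS|iS] := boolP (i \in S); last by rewrite ins_signU1 // ltnn mul1r.
by rewrite (setUidPr _) // sub1set.
Qed.

Lemma ins_signU i S T : [disjoint S & T] -> ins_sign i (S :|: T)%SET = ins_sign i S * ins_sign i T.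
Proof. by move=> dST; rewrite !ins_signE -bigU //=; apply: eq_bigl => k; rewrite !inE. Qed.

Lemma ext_signU1 i S T : i \notin S ->
  ext_sign F (i |: S)%SET T = ins_sign i T * ext_sign F S T.
Proof. by move=> iS; rewrite ins_signE !ext_signE big_setU1. Qed.

(** The source of every anticommutation below: of two distinct indices exactly
    one exceeds the other. *)
Lemma sign_ltnC i j : i != j -> (-1) ^+ (i < j)%N = - (-1) ^+ (j < i)%N :> F.
Proof.
rewrite -val_eqE /= neq_ltn => /orP[] h; rewrite h ltnNge (ltnW h) /=.
  by rewrite expr0 expr1.
by rewrite expr0 expr1 opprK.
Qed.

Fact wedge_linear phi : linear (wedge phi).
Proof.
move=> c a b; apply/ffunP => S; rewrite !ffunE scaler_sumr -big_split /=.
apply: eq_bigr => T _; rewrite !ffunE /= mulrDr; congr (_ + _).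
by rewrite /GRing.scale /= mulrCA.
Qed.

HB.instance Definition _ phi :=
  GRing.isLinear.Build F (ext F n) (ext F n) _ (wedge phi) (wedge_linear phi).

Lemma wedge_linearl psi : linear (fun phi : ext F n => wedge phi psi : ext F n).
Proof.
move=> c a b; apply/ffunP => S; rewrite !ffunE scaler_sumr -big_split /=.
apply: eq_bigr => T _; rewrite !ffunE /= mulrDr mulrDl; congr (_ + _).
by rewrite /GRing.scale /= mulrCA !mulrA.
Qed.

Lemma wedgeLE phi psi : wedgeL phi psi = wedge phi psi.
Proof. by rewrite /wedgeL lfunE. Qed.

Lemma wedgeL_linear : linear (@wedgeL F n).
Proof.
move=> c a b; apply/lfunP => psi.
by rewrite add_lfunE scale_lfunE !wedgeLE wedge_linearl.
Qed.

Lemma form1_linear : linear (@form1 F n).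
Proof.
move=> c a b; apply/ffunP => S; rewrite !ffunE scaler_sumr -big_split /=.
by apply: eq_bigr => T _; rewrite !mxE.
Qed.

Definition ext_mul u : 'End(ext F n) := wedgeL (form1 u).

Lemma ext_mulE u phi S :
  ext_mul u phi S = \sum_(i in S) ins_sign i S * u 0 i * phi (S :\ i)%SET.
Proof.
rewrite wedgeLE ffunE.
under eq_bigr do rewrite ffunE mulrAC big_distrr /=.
rewrite (exchange_big_dep predT) //= [RHS]big_mkcond /=.
apply: eq_bigr => i _.
have [iS|iS] := boolP (i \in S).
  rewrite (big_pred1 [set i]%SET) /=; last first.
    by move=> T; rewrite andb_idl // => /eqP->; rewrite sub1set.
  by rewrite -/(ins_sign _ _) ins_signD1_same mulrAC.
rewrite big1 // => T /andP[TS /eqP TE]; move: TS; rewrite TE sub1set.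
by rewrite (negPf iS).
Qed.

Fact contraction_linear u : linear (fun phi : ext F n =>
  [ffun S : {set 'I_n} => \sum_(i | i \notin S)
     ext_sign F [set i]%SET S * u 0 i * phi (i |: S)%SET] : ext F n).
Proof.
move=> c a b; apply/ffunP => S; rewrite !ffunE scaler_sumr -big_split /=.
apply: eq_bigr => T _; rewrite !ffunE /= mulrDr; congr (_ + _).
by rewrite /GRing.scale /= mulrCA.
Qed.

Lemma contractionE t phi S :
  contraction t phi S = \sum_(i | i \notin S) ins_sign i S * t 0 i * phi (i |: S)%SET.
Proof.
pose f : {linear ext F n -> ext F n} := HB.pack (fun phi : ext F n =>
  [ffun S : {set 'I_n} => \sum_(i | i \notin S)
     ext_sign F [set i]%SET S * t 0 i * phi (i |: S)%SET] : ext F n)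
  (GRing.isLinear.Build _ _ _ _ _ (contraction_linear t)).
by rewrite /contraction (lfunE f) ffunE.
Qed.

Lemma ext_mul_linear : linear ext_mul.
Proof. by move=> c a b; rewrite /ext_mul form1_linear wedgeL_linear. Qed.

Lemma contraction_linearl : linear (@contraction F n).
Proof.
move=> c a b; apply/lfunP => phi; apply/ffunP => S.
rewrite add_lfunE scale_lfunE !ffunE !contractionE scaler_sumr -big_split /=.
apply: eq_bigr => T _; rewrite !mxE mulrDr mulrDl; congr (_ + _).
by rewrite /GRing.scale /= mulrCA !mulrA.
Qed.

Lemma ext_mul_anticomm u v phi :
  ext_mul u (ext_mul v phi) + ext_mul v (ext_mul u phi) = 0.
Proof.
apply/ffunP => S; rewrite !ffunE !ext_mulE.
under eq_bigr do rewrite ext_mulE big_distrr /=.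
under [X in _ + X]eq_bigr do rewrite ext_mulE big_distrr /=.
rewrite (exchange_big_dep (mem S)) /=; last by move=> i j _ /setD1P[].
rewrite -big_split /= big1 // => i iS.
rewrite (eq_bigl (mem (S :\ i))); last first.
  by move=> j; rewrite !inE; case: eqVneq => [->|]; rewrite ?eqxx ?iS ?andbF ?andbT.
rewrite -big_split /= big1 // => j /setD1P[ji jS].
rewrite !ins_signD1 // (sign_ltnC ji).
have -> : (S :\ i :\ j = S :\ j :\ i)%SET by apply/setP => k; rewrite !inE andbCA.
ring.
Qed.

Lemma contraction_anticomm t s phi :
  contraction t (contraction s phi) + contraction s (contraction t phi) = 0.
Proof.
apply/ffunP => S; rewrite !ffunE !contractionE.
under eq_bigr do rewrite contractionE big_distrr /=.
under [X in _ + X]eq_bigr do rewrite contractionE big_distrr /=.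
rewrite (exchange_big_dep (fun j => j \notin S)) /=; last first.
  by move=> i j _; rewrite !inE negb_or => /andP[].
rewrite -big_split /= big1 // => i iS.
rewrite (eq_bigl (fun j => j \notin i |: S)%SET); last first.
  move=> j; rewrite !inE !negb_or eq_sym.
  by case: eqVneq => [->|]; rewrite ?eqxx ?iS ?andbF ?andbT.
rewrite -big_split /= big1 // => j; rewrite !inE negb_or => /andP[ji jS].
rewrite !ins_signU1 // (sign_ltnC ji).
have -> : (i |: (j |: S) = j |: (i |: S))%SET by apply/setP => k; rewrite !inE orbCA.
ring.
Qed.

(** In the double sums, the terms with distinct indices cancel in pairs; the
    diagonal terms give [t 0 i * u 0 i * phi S] once for each i, from the first
    product if i is outside S and from the second if it is inside. *)
Lemma contraction_ext_mul t u phi :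
  contraction t (ext_mul u phi) + ext_mul u (contraction t phi)
    = (t *m u^T) 0 0 *: phi.
Proof.
apply/ffunP => S; rewrite !ffunE contractionE ext_mulE.
under eq_bigr do rewrite ext_mulE big_distrr /=.
under [X in _ + X]eq_bigr do rewrite contractionE big_distrr /=.
(* isolate the diagonal term of contraction after multiplication *)
have key i : i \notin S -> \sum_(j in (i |: S)%SET)
    ins_sign i S * t 0 i * (ins_sign j (i |: S)%SET * u 0 j * phi ((i |: S) :\ j)%SET)
  = t 0 i * u 0 i * phi S - \sum_(j in S)
    ins_sign j S * u 0 j * (ins_sign i (S :\ j)%SET * t 0 i * phi (i |: (S :\ j))%SET).
  move=> iS; rewrite big_setU1 //=; congr (_ + _).
    rewrite ins_signU1_same setU1K //.
    transitivity ((ins_sign i S * ins_sign i S) * (t 0 i * u 0 i * phi S)); first by ring.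
    by rewrite ins_sign_sqr mul1r.
  rewrite -sumrN; apply: eq_bigr => j jS.
  have ij : i != j by apply: contraNneq iS => ->.
  rewrite ins_signU1 // ins_signD1 // (sign_ltnC ij).
  have -> : ((i |: S) :\ j = i |: (S :\ j))%SET.
    by apply/setP => k; rewrite !inE; case: (eqVneq k i) => //= ->; rewrite ij.
  ring.
under eq_bigr => i iS do rewrite (key i iS).
(* and that of multiplication after contraction *)
have key2 i : i \in S -> \sum_(j | j \notin (S :\ i)%SET)
    ins_sign i S * u 0 i * (ins_sign j (S :\ i)%SET * t 0 j * phi (j |: S :\ i)%SET)
  = t 0 i * u 0 i * phi S + \sum_(j | j \notin S)
    ins_sign i S * u 0 i * (ins_sign j (S :\ i)%SET * t 0 j * phi (j |: S :\ i)%SET).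
  move=> iS; rewrite (bigD1 i) /=; last by rewrite setD11.
  congr (_ + _); last first.
    apply: eq_bigl => j; rewrite !inE.
    by case: (eqVneq j i) => //= [->|_]; rewrite ?iS ?andbT.
  rewrite ins_signD1_same setD1K //.
  transitivity ((ins_sign i S * ins_sign i S) * (t 0 i * u 0 i * phi S)); first by ring.
  by rewrite ins_sign_sqr mul1r.
rewrite big_split /= sumrN exchange_big /=.
rewrite (eq_bigr _ key2) [X in _ + X]big_split /=.
rewrite [X in _ + X]addrC addrA subrK.
rewrite /GRing.scale /= mxE mulr_suml [RHS](bigID (fun i => i \in S)) /= addrC.
by congr (_ + _); apply: eq_bigr => i _; rewrite !mxE.
Qed.

(** The case of associativity used to extend identities from degree one: subsets T
    of S containing i correspond to subsets of S without i by T |-> T minus i. *)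
Lemma ext_mul_wedge u phi psi :
  ext_mul u (wedge phi psi) = wedge (ext_mul u phi) psi.
Proof.
apply/ffunP => S; rewrite ext_mulE [RHS]ffunE.
under [RHS]eq_bigr do rewrite ext_mulE mulrAC big_distrr /=.
rewrite (exchange_big_dep (mem S)) /=; last by move=> T i /fintype.subsetP TS /TS.
apply: eq_bigr => i iS; rewrite ffunE big_distrr /=.
rewrite [RHS](reindex_onto (fun T => i |: T)%SET (fun T => T :\ i)%SET) /=; last first.
  by move=> T /andP[_ iT]; rewrite setD1K.
apply: eq_big => [T|T TS].
  rewrite setU11 andbT subUset sub1set iS /= subsetD1.
  have [iT|iT] := boolP (i \in T).
    rewrite andbF; apply/esym/negbTE; rewrite negb_and; apply/orP; right.
    by apply: contraTneq iT => <-; rewrite setD11.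
  by rewrite setU1K ?eqxx.
have iT : i \notin T by apply: contraTN TS => iT; rewrite subsetD1 iT andbF.
rewrite ext_signU1 // setU1K // ins_signU1_same.
have -> : (S :\ i :\: T = S :\: (i |: T))%SET.
  by apply/setP => k; rewrite !inE negb_or andbCA andbA.
have -> : ins_sign i S = ins_sign i T * ins_sign i (S :\: (i |: T))%SET.
  rewrite -(ins_signU1_same i T) -ins_signU; last first.
    by rewrite disjoint_sym disjoints_subset; apply/fintype.subsetP => k; rewrite !inE => /andP[].
  congr ins_sign; apply/setP => k; rewrite !inE.
  case: (eqVneq k i) => [->|_] //=; have [kT|//] := boolP (k \in T).
  by move/fintype.subsetP/(_ k kT): TS; rewrite !inE => /andP[].
ring.
Qed.

End ExteriorAlgebra.

(** * The exterior algebra is generated by its unit and by one-forms *)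
Section Generation.
Variables (F : fieldType) (n : nat).
Implicit Types (phi psi : ext F n) (S T : {set 'I_n}) (i j : 'I_n).
Implicit Types (u v t s a : 'rV[F]_n).

Definition ext_basis S : ext F n := [ffun T : {set 'I_n} => (T == S)%:R].

Definition evec i : 'rV[F]_n := delta_mx 0 i.

Lemma ext_basis_sum phi : phi = \sum_S phi S *: ext_basis S.
Proof.
apply/ffunP => T; rewrite sum_ffunE (bigD1 T) //= big1 ?addr0.
  by rewrite !ffunE eqxx [RHS]mulr1.
by move=> S ST; rewrite !ffunE eq_sym (negPf ST) [LHS]mulr0.
Qed.

Lemma ext_mul_evec i phi S :
  ext_mul (evec i) phi S = if i \in S then ins_sign F i S * phi (S :\ i)%SET else 0.
Proof.
rewrite ext_mulE; case: ifP => [iS|/negbT iS].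
  rewrite (bigD1 i) //= big1 ?addr0; first by rewrite mxE !eqxx mulr1.
  by move=> k /andP[_ ki]; rewrite mxE (negPf ki) andbF mulr0 mul0r.
apply: big1 => k kS; rewrite mxE.
by case: (eqVneq k i) kS => [->|_ _]; rewrite ?(negPf iS) // andbF mulr0 mul0r.
Qed.

Lemma contraction_evec i phi S :
  contraction (evec i) phi S = if i \in S then 0 else ins_sign F i S * phi (i |: S)%SET.
Proof.
rewrite contractionE; case: ifP => [iS|/negbT iS].
  apply: big1 => k kS; rewrite mxE.
  by case: (eqVneq k i) kS => [->|_ _]; rewrite ?iS // andbF mulr0 mul0r.
rewrite (bigD1 i) //= big1 ?addr0; first by rewrite mxE !eqxx mulr1.
by move=> k /andP[_ ki]; rewrite mxE (negPf ki) andbF mulr0 mul0r.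
Qed.

Lemma ext_mul_evec_basis i S :
  ext_mul (evec i) (ext_basis S)
    = if i \in S then 0 else ins_sign F i S *: ext_basis (i |: S)%SET.
Proof.
apply/ffunP => T; rewrite ext_mul_evec.
case: (boolP (i \in S)) => iS; rewrite !ffunE.
  case: ifP => // iT; case: eqP => [E|]; last by rewrite mulr0.
  by move: iS; rewrite -E setD11.
case: ifP => [iT|/negbT iT].
  rewrite /GRing.scale /=; case: (eqVneq T (i |: S)%SET) => [->|TS].
    by rewrite setU1K // eqxx ins_signU1_same.
  case: eqP => [E|]; last by rewrite !mulr0.
  by case/eqP: TS; rewrite -E setD1K.
case: eqP => [E|]; last by rewrite scaler0.
by rewrite E setU11 in iT.
Qed.

(** The Fock-space form of induction: every form is a combination of iterated
    products of one-forms applied to the unit form. *)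
Lemma ext_ind (P : ext F n -> Prop) :
  P (ext_basis set0) ->
  (forall c phi psi, P phi -> P psi -> P (c *: phi + psi)) ->
  (forall u phi, P phi -> P (ext_mul u phi)) ->
  forall phi, P phi.
Proof.
move=> P1 PL PM.
have P0 : P 0 by rewrite -(addNr (ext_basis set0)) -scaleN1r; apply: PL.
have PZ c phi : P phi -> P (c *: phi) by move=> h; rewrite -[_ *: _]addr0; apply: PL.
have PB S : P (ext_basis S).
  elim: {S}_.+1 {-2}S (ltnSn #|S|) => // m IH S Sm.
  have [->//|[i iS]] := set_0Vmem S.
  have -> : ext_basis S = ins_sign F i S *: ext_mul (evec i) (ext_basis (S :\ i)%SET).
    rewrite ext_mul_evec_basis setD11 setD1K // scalerA ins_signD1_same.
    by rewrite ins_sign_sqr scale1r.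
  apply: PZ; apply: PM; apply: IH.
  by rewrite (cardsD1 i) iS add1n ltnS in Sm.
move=> phi; rewrite (ext_basis_sum phi).
elim/big_ind: _ => // [x y Px Py|S _]; last exact: PZ.
by rewrite -[x]scale1r; apply: PL.
Qed.

Lemma wedge1l psi : wedge (ext_basis set0) psi = psi.
Proof.
apply/ffunP => S; rewrite ffunE (bigD1 set0) ?finset.sub0set //= big1 ?addr0.
  rewrite ffunE eqxx mulr1 setD0 ext_signE big_set0 mul1r //.
by move=> T /andP[_ T0]; rewrite ffunE (negPf T0) mulr0 mul0r.
Qed.

Lemma contraction1 t : contraction t (ext_basis set0) = 0.
Proof.
apply/ffunP => S; rewrite contractionE ffunE big1 // => i iS.
rewrite ffunE (_ : _ == _ = false) ?mulr0 //.
by apply/negbTE/set0Pn; exists i; rewrite setU11.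
Qed.

Lemma wedge0l psi : wedge 0 psi = 0.
Proof.
have h := wedge_linearl psi (-1) 0 0; move: h.
by rewrite !scaleN1r !addNr.
Qed.

Lemma wedgeDl phi phi' psi : wedge (phi + phi') psi = wedge phi psi + wedge phi' psi.
Proof. by have := wedge_linearl psi 1 phi phi'; rewrite !scale1r. Qed.

Lemma wedgeZl c phi psi : wedge (c *: phi) psi = c *: wedge phi psi.
Proof. by have := wedge_linearl psi c phi 0; rewrite wedge0l !addr0. Qed.

(** Commuting past a one-form u replaces it by the one-form u(t) a, which is the
    Leibniz rule on generators. *)
Lemma derivation_ext_mul_contraction a t :
  derivation (ext_mul a \o contraction t)%VF.
Proof.
move=> phi psi; rewrite !comp_lfunE.
elim/ext_ind: phi psi => [|c phi phi' IH IH'|u phi IH] psi.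
- by rewrite !wedge1l contraction1 linear0 wedge0l add0r.
- rewrite !(wedgeDl, wedgeZl, linearD, linearZ) /= IH IH'.
  by rewrite scalerDr addrACA.
have CM v chi : contraction t (ext_mul v chi)
    = (t *m v^T) 0 0 *: chi - ext_mul v (contraction t chi).
  by rewrite -contraction_ext_mul addrK.
have MM v w chi : ext_mul v (ext_mul w chi) = - ext_mul w (ext_mul v chi).
  by apply/eqP; rewrite -addr_eq0 ext_mul_anticomm.
rewrite -ext_mul_wedge !CM !linearB !linearZ /= (MM a u) (MM a u) !opprK IH.
by rewrite !linearD /= wedgeDl wedgeZl -!ext_mul_wedge addrA.
Qed.

Lemma form2_linear : linear (@form2 F n).
Proof.
move=> c A B; apply/ffunP => S; rewrite !ffunE scaler_sumr -big_split /=.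
apply: eq_bigr => i _; rewrite scaler_sumr -big_split /=.
by apply: eq_bigr => j _; rewrite !mxE.
Qed.

Lemma wedgeL_wedge_form1 u v :
  wedgeL (wedge (form1 u) (form1 v)) = (ext_mul u \o ext_mul v)%VF.
Proof.
apply/lfunP => phi; rewrite wedgeLE comp_lfunE.
by rewrite -(wedgeLE (form1 u) (form1 v)) -/(ext_mul u) -ext_mul_wedge -wedgeLE.
Qed.

(** The rank one operators of contraction followed by multiplication act on
    one-forms as the endomorphism u |-> u(t) a, and on vectors as minus its
    transpose. *)
Lemma bracket_ext_mul_contraction_mul a t u :
  lie_bracket (ext_mul a \o contraction t) (ext_mul u) = (t *m u^T) 0 0 *: ext_mul a.
Proof.
apply/lfunP => phi; rewrite /lie_bracket add_lfunE opp_lfunE !comp_lfunE scale_lfunE.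
rewrite -linearZ -contraction_ext_mul linearD /=.
have /eqP := ext_mul_anticomm a u (contraction t phi).
by rewrite addr_eq0 => /eqP ->.
Qed.

Lemma bracket_ext_mul_contraction_contraction a t s :
  lie_bracket (ext_mul a \o contraction t) (contraction s)
    = - ((s *m a^T) 0 0 *: contraction t).
Proof.
apply/lfunP => phi; rewrite /lie_bracket add_lfunE !(comp_lfunE, opp_lfunE) scale_lfunE.
rewrite -contraction_ext_mul opprD addrC; congr (_ + _).
apply/eqP; rewrite -addr_eq0 -linearD /=.
by rewrite contraction_anticomm linear0.
Qed.

End Generation.

Lemma wedge_form1 (R : realType) n (u v : 'rV[R]_n) :
  wedge (form1 u) (form1 v) = form2 (wedge2 u v).
Proof.
have symE (i j : 'I_n) (S : {set 'I_n}) : (S == [set j; i])%SET = (S == [set i; j])%SET.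
  by congr (_ == _); apply/setP => k; rewrite !inE orbC.
apply/ffunP => S; rewrite -wedgeLE -/(ext_mul _) ext_mulE [RHS]ffunE.
transitivity (\sum_i \sum_(j | (i != j) && (S == [set i; j])%SET)
    (-1) ^+ (j < i)%N * (u 0 i * v 0 j)).
  rewrite big_mkcond /=; apply: eq_bigr => i _; case: ifP => [iS|/negbT iS].
    rewrite ffunE big_distrr /=; apply: eq_big => [j|j /eqP SE].
      apply/eqP/andP => [SE|[ij /eqP->]].
        split; last by rewrite -SE setD1K.
        apply: contraTneq (set11 j) => ij.
        by rewrite -SE -ij setD11.
      by rewrite setU1K // inE.
    have ij : i \notin [set j]%SET by rewrite -SE setD11.
    rewrite -(setD1K iS) SE ins_signU1_same.
    by rewrite ins_signE big_set1 mulrA.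
  rewrite big1 // => j /andP[_ /eqP SE]; move: iS.
  by rewrite SE !inE eqxx.
have split_ij i : \sum_(j | (i != j) && (S == [set i; j])%SET)
    (-1) ^+ (j < i)%N * (u 0 i * v 0 j)
  = \sum_(j : 'I_n | (i < j)%N && (S == [set i; j])%SET) u 0 i * v 0 j
    - \sum_(j : 'I_n | (j < i)%N && (S == [set i; j])%SET) u 0 i * v 0 j.
  rewrite (bigID (fun j : 'I_n => (i < j)%N)) /=; congr (_ + _).
    apply: eq_big => [j|j]; last first.
      by case/andP=> _ ij; rewrite ltnNge (ltnW ij) mul1r.
    by rewrite -val_eqE /= neq_ltn; case: (ltngtP i j); rewrite ?andbF ?andbT.
  rewrite -sumrN; apply: eq_big => [j|j].
    by rewrite -val_eqE /= neq_ltn; case: (ltngtP i j); rewrite ?andbF ?andbT.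
  rewrite -val_eqE /= neq_ltn => /andP[/andP[ij _]]; rewrite -leqNgt => ji.
  by move: ij; rewrite ltnNge ji /= => ->; rewrite expr1 mulN1r.
rewrite (eq_bigr _ (fun i _ => split_ij i)) big_split /= sumrN.
rewrite [X in _ - X](exchange_big_dep predT) //= -sumrB; apply: eq_bigr => i _.
rewrite [X in _ - X](eq_bigl (fun j : 'I_n => (i < j)%N && (S == [set i; j])%SET));
  last first.
  by move=> j; rewrite symE.
rewrite -sumrB; apply: eq_bigr => j _.
by rewrite /wedge2 !mxE !big_ord1 !mxE mulrC; congr (_ - _); rewrite mulrC.
Qed.

(** * Laplace expansion of the minors indexed by sets *)
Section Minors.
Variables (F : fieldType) (n : nat).
Implicit Types (phi psi : ext F n) (S T : {set 'I_n}) (i j k : 'I_n).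
Implicit Types (A : 'M[F]_n).

Lemma nth_rem (T : eqType) (x0 x : T) (s : seq T) (a : nat) : x \in s ->
  nth x0 (rem x s) a = nth x0 s (bump (index x s) a).
Proof.
elim: s a => //= y s IH a; rewrite in_cons eq_sym; case: eqVneq => [->|yx] //= xs.
by case: a => //= a; rewrite IH // /bump ltnS addnS.
Qed.

Lemma enum_setD1 k T : enum (T :\ k)%SET = rem k (enum T).
Proof.
rewrite rem_filter ?enum_uniq // /enum_mem -filter_predI.
by apply: eq_filter => i /=; rewrite !inE.
Qed.

Lemma ins_sign_index i T : i \in T -> ins_sign F i T = (-1) ^+ index i (enum T).
Proof.
move=> iT; rewrite ins_signE -big_enum prodrXr /=; congr (_ ^+ _).
have : sorted (fun a b : 'I_n => (a < b)%N) (enum T).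
  rewrite /enum_mem; apply: sorted_filter; first by move=> x y z; apply: ltn_trans.
  by rewrite -enumT -(sorted_map (f := @nat_of_ord n) (e' := ltn)) val_enum_ord iota_ltn_sorted.
have : i \in enum T by rewrite mem_enum.
elim: (enum T) => // x s IH; rewrite inE /= => ixs; rewrite path_sortedE; last first.
  by move=> a b c; apply: ltn_trans.
case/andP=> xs ss; rewrite big_cons eq_sym; case: (eqVneq i x) ixs => [->|ix] /= ixs.
  rewrite ltnn big1_seq // => t /andP[_ ts].
  by rewrite ltnNge (ltnW (allP xs _ ts)).
by rewrite (allP xs _ ixs) IH.
Qed.

Lemma set_minor_nth A S T (m : nat) (x0 : 'I_n) : #|S| = m -> #|T| = m ->
  set_minor A S T
  = \det (\matrix_(a < m, b < m) A (nth x0 (enum S) a) (nth x0 (enum T) b)).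
Proof.
move=> Sm Tm; rewrite /set_minor; subst m; congr (\det _); apply/matrixP => a b.
rewrite !mxE (enum_val_nth x0); congr (A _ _); apply: set_nth_default.
by rewrite -cardE Tm.
Qed.

(** Expansion along the row i.  In the increasing enumeration of a set, the position
    of an element is the exponent of its insertion sign. *)
Lemma set_minor_expand A i S T : i \notin S -> #|T| = #|S|.+1 ->
  ins_sign F i S * set_minor A (i |: S)%SET T
  = \sum_(k in T) ins_sign F k T * A i k * set_minor A S (T :\ k)%SET.
Proof.
move=> iS cT; have ciS : #|(i |: S)%SET| = #|S|.+1 by rewrite cardsU1 iS add1n.
have iiS : i \in enum (i |: S)%SET by rewrite mem_enum setU11.
have rlt : (index i (enum (i |: S)%SET) < #|S|.+1)%N by rewrite -ciS cardE index_mem.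
pose r : 'I_#|S|.+1 := Ordinal rlt.
rewrite (set_minor_nth A i ciS cT) (expand_det_row _ r).
rewrite -[RHS]big_enum [RHS](big_nth i) -cardE cT big_mkord big_distrr /=.
apply: eq_bigr => b _; rewrite mxE /cofactor.
set k := nth i (enum T) b.
have bT : (b < size (enum T))%N by rewrite -cardE cT.
have kT : k \in enum T by rewrite mem_nth.
have kTs : k \in T by rewrite -mem_enum.
have -> : nth i (enum (i |: S)%SET) r = i by rewrite nth_index.
have -> : ins_sign F k T = (-1) ^+ b by rewrite ins_sign_index // /k index_uniq ?enum_uniq.
have -> : ins_sign F i S = (-1) ^+ r.
  by rewrite -(ins_signU1_same F i) ins_sign_index ?setU11.
have cTk : #|(T :\ k)%SET| = #|S| by move: cT; rewrite (cardsD1 k) kTs => -[].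
rewrite (set_minor_nth A i (erefl #|S|) cTk).
have -> : row' r (col' b (\matrix_(a, b0) A (nth i (enum (i |: S)%SET) a) (nth i (enum T) b0)))
  = \matrix_(a < #|S|, b0 < #|S|) A (nth i (enum S) a) (nth i (enum (T :\ k)%SET) b0).
  apply/matrixP => c d; rewrite !mxE.
  have -> : enum S = rem i (enum (i |: S)%SET) by rewrite -enum_setD1 setU1K.
  by rewrite !enum_setD1 !nth_rem // /k index_uniq ?enum_uniq.
rewrite exprD; set x := (-1) ^+ r; set y := (-1) ^+ b; set d := \det _.
have -> : x * (A i k * (x * y * d)) = (x * x) * (y * A i k * d) by ring.
by rewrite -expr2 sqrr_sign mul1r.
Qed.

Lemma set_minor0 A : set_minor A set0 set0 = 1.
Proof.
rewrite /set_minor.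
have : forall m (M : 'M[F]_m), m = 0%N -> \det M = 1.
  by move=> m M m0; subst m; rewrite det_mx00.
by apply; rewrite cards0.
Qed.

End Minors.

(** * Adjoints for the inner product on forms *)
Section Adjoints.
Variables (F : numFieldType) (n : nat) (g : 'M[F]_n).
Implicit Types (phi psi : ext F n) (S T : {set 'I_n}) (i j k : 'I_n).
Implicit Types (u v : 'rV[F]_n) (D E : 'End(ext F n)).

Lemma ext_dot_linearl psi : linear (fun phi => ext_dot g phi psi : F^o).
Proof.
move=> c a b; rewrite scaler_sumr -big_split /=; apply: eq_bigr => S _.
rewrite scaler_sumr -big_split /=; apply: eq_bigr => T _.
by rewrite !ffunE /GRing.scale /=; ring.
Qed.

Lemma ext_dot_linearr phi : linear (fun psi => ext_dot g phi psi : F^o).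
Proof.
move=> c a b; rewrite scaler_sumr -big_split /=; apply: eq_bigr => S _.
rewrite scaler_sumr -big_split /=; apply: eq_bigr => T _.
by rewrite !ffunE /GRing.scale /=; ring.
Qed.

Let dotl psi : {linear ext F n -> F^o} :=
  HB.pack (fun phi => ext_dot g phi psi : F^o)
    (GRing.isLinear.Build _ _ _ _ _ (ext_dot_linearl psi)).
Let dotr phi : {linear ext F n -> F^o} :=
  HB.pack (fun psi => ext_dot g phi psi : F^o)
    (GRing.isLinear.Build _ _ _ _ _ (ext_dot_linearr phi)).

Lemma ext_dot0l psi : ext_dot g 0 psi = 0.
Proof. exact: (linear0 (dotl psi)). Qed.

Lemma ext_dot0r phi : ext_dot g phi 0 = 0.
Proof. exact: (linear0 (dotr phi)). Qed.

Lemma ext_dotZl c phi psi : ext_dot g (c *: phi) psi = c * ext_dot g phi psi.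
Proof. by have := ext_dot_linearl psi c phi 0; rewrite ext_dot0l !addr0. Qed.

Lemma ext_dotZr c phi psi : ext_dot g phi (c *: psi) = c * ext_dot g phi psi.
Proof. by have := ext_dot_linearr phi c psi 0; rewrite ext_dot0r !addr0. Qed.

Lemma ext_dotBr phi psi psi' :
  ext_dot g phi (psi - psi') = ext_dot g phi psi - ext_dot g phi psi'.
Proof. exact: (linearB (dotr phi)). Qed.

Lemma ext_dot_suml (I : finType) (f : I -> ext F n) psi :
  ext_dot g (\sum_i f i) psi = \sum_i ext_dot g (f i) psi.
Proof. exact: (linear_sum (dotl psi)). Qed.

Lemma ext_dot_sumr (I : finType) phi (f : I -> ext F n) :
  ext_dot g phi (\sum_i f i) = \sum_i ext_dot g phi (f i).
Proof. exact: (linear_sum (dotr phi)). Qed.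

Lemma ext_dot_basisl S psi : ext_dot g (ext_basis F S) psi =
  \sum_(T : {set 'I_n} | #|T| == #|S|) psi T * set_minor (invmx g) S T.
Proof.
rewrite /ext_dot (bigD1 S) //= [X in _ + X]big1 ?addr0.
  by apply: eq_bigr => T _; rewrite ffunE eqxx mul1r.
by move=> S' S'S; rewrite big1 // => T _; rewrite ffunE (negPf S'S) !mul0r.
Qed.

Let igrow i := row i (invmx g).

(** On both sides one sums over a set T of columns and an element k of T; the two
    sums correspond by removing k from T. *)
Lemma ext_dot_mul_basis_notin i S psi : i \notin S ->
  ext_dot g (ext_mul (evec F i) (ext_basis F S)) psi
  = ext_dot g (ext_basis F S) (contraction (igrow i) psi).
Proof.
move=> iS; rewrite ext_mul_evec_basis (negPf iS).
rewrite ext_dotZl !ext_dot_basisl.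
rewrite cardsU1 iS add1n big_distrr /=.
under eq_bigr => T /eqP cT do rewrite mulrCA set_minor_expand // big_distrr /=.
under [RHS]eq_bigr do rewrite contractionE mulr_suml.
rewrite !pair_big_dep /=.
rewrite [LHS](reindex_onto (fun p : {set 'I_n} * 'I_n => (p.2 |: p.1, p.2)%SET)
   (fun p => (p.1 :\ p.2, p.2)%SET)) /=; last first.
  by move=> [T k] /= /andP[_ kT]; rewrite setD1K.
apply: eq_big => [[T k]|[T k]] /=.
  rewrite setU11 andbT; have [kT|kT] := boolP (k \in T).
    rewrite andbF; apply/negbTE/nandP; right.
    by apply: contraTneq kT => -[<-]; rewrite setD11.
  by rewrite setU1K // cardsU1 kT add1n eqSS eqxx andbT.
case/andP=> /andP[_ _] /eqP[TE].
rewrite ins_signU1_same TE mxE; ring.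
Qed.

Lemma ext_dot_mul_evec i phi psi :
  ext_dot g (ext_mul (evec F i) phi) psi
  = ext_dot g phi (contraction (igrow i) psi).
Proof.
rewrite (ext_basis_sum phi) linear_sum /= !ext_dot_suml.
apply: eq_bigr => S _; rewrite linearZ /= !ext_dotZl; congr (_ * _).
(* If i is in S the left side vanishes; moving e_i out of e_S turns the right side
   into a pairing with a double contraction, which vanishes too. *)
have [iS|] := boolP (i \in S); last exact: ext_dot_mul_basis_notin.
rewrite ext_mul_evec_basis iS ext_dot0l.
have -> : ext_basis F S
    = ins_sign F i S *: ext_mul (evec F i) (ext_basis F (S :\ i)%SET).
  rewrite ext_mul_evec_basis setD11 setD1K // scalerA ins_signD1_same.
  by rewrite ins_sign_sqr scale1r.
rewrite ext_dotZl ext_dot_mul_basis_notin ?setD11 //.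
have -> : contraction (igrow i) (contraction (igrow i) psi) = 0.
  apply/eqP; have /eqP := contraction_anticomm (igrow i) (igrow i) psi.
  by rewrite -mulr2n -scaler_nat scaler_eq0 pnatr_eq0.
by rewrite ext_dot0r mulr0.
Qed.

Lemma ext_dot_ext_mul u phi psi :
  ext_dot g (ext_mul u phi) psi
  = ext_dot g phi (contraction (u *m invmx g) psi).
Proof.
rewrite {1}(row_sum_delta u) mulmx_sum_row.
rewrite (linear_map_sum (@ext_mul_linear F n)) (linear_map_sum (@contraction_linearl F n)).
rewrite !sum_lfunE ext_dot_suml ext_dot_sumr; apply: eq_bigr => i _.
rewrite (linear_mapZ (@ext_mul_linear F n)) (linear_mapZ (@contraction_linearl F n)).
by rewrite !scale_lfunE ext_dotZl ext_dotZr ext_dot_mul_evec.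
Qed.

Hypothesis g_unit : g \in unitmx.

(** By adjunction the forms orthogonal to everything are stable under contraction,
    and repeated contraction turns any coefficient of a form into its degree zero
    coefficient, which is the pairing with the unit form. *)
Lemma ext_dot_nondegenerate psi : (forall phi, ext_dot g phi psi = 0) -> psi = 0.
Proof.
move=> h; apply/ffunP => S; rewrite ffunE.
elim: {S}_.+1 {-2}S (ltnSn #|S|) psi h => // m IH S Sm psi h.
have [->|[i iS]] := set_0Vmem S.
  have := h (ext_basis F set0); rewrite ext_dot_basisl cards0.
  rewrite (big_pred1 set0) ?set_minor0 ?mulr1 //.
  by move=> T; rewrite /= cards_eq0.
have /(IH (S :\ i)%SET) : forall phi, ext_dot g phi (contraction (evec F i) psi) = 0.
  move=> phi; have <- := h (ext_mul (evec F i *m g) phi).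
  by rewrite ext_dot_ext_mul mulmxK.
rewrite contraction_evec setD11 setD1K // => /(_ _)/eqP.
rewrite mulf_eq0 => H; have /orP[|/eqP->//] : (ins_sign F i (S :\ i)%SET == 0) || (psi S == 0).
  by apply: H; rewrite (cardsD1 i) iS add1n ltnS in Sm.
move=> /eqP s0; have := ins_sign_sqr F i (S :\ i)%SET.
by rewrite s0 mul0r => /esym/eqP; rewrite oner_eq0.
Qed.

Lemma adjoint_unique D E :
  (forall phi psi, ext_dot g (D phi) psi = ext_dot g phi (E psi)) ->
  adjoint g D = E.
Proof.
move=> DE; rewrite /adjoint; case: xgetP => [E' _ DE'|/(_ E)//].
apply/lfunP => psi; apply/eqP; rewrite -subr_eq0; apply/eqP.
apply: ext_dot_nondegenerate => phi; by rewrite ext_dotBr -DE' DE subrr.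
Qed.

Lemma adjoint_ext_mul2 u v :
  adjoint g (ext_mul u \o ext_mul v)%VF
  = (contraction (v *m invmx g) \o contraction (u *m invmx g))%VF.
Proof.
apply: adjoint_unique => phi psi.
by rewrite !comp_lfunE !ext_dot_ext_mul.
Qed.

End Adjoints.

(** * Linear and Lie spans *)
Section Generated.
Variables (K : fieldType) (V : vectType K).

Lemma lin_spanW (G A : set V) : lin_closed A -> (forall D, G D -> A D) ->
  forall D, lin_span G D -> A D.
Proof. by move=> cA GA D; apply; split. Qed.

Lemma lin_span_gen (G : set V) D : G D -> lin_span G D.
Proof. by move=> GD A [_]; apply. Qed.

Lemma lin_span_closed (G : set V) : lin_closed (lin_span G).
Proof.
split=> [A [[A0 _] _] //|c D E hD hE A cA].
by case: (cA) => -[_ AL] _; apply: AL; [apply: hD|apply: hE].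
Qed.

Lemma lie_generatedW (G A : set 'End(V)) : lie_closed A -> (forall D, G D -> A D) ->
  forall D, lie_generated G D -> A D.
Proof. by move=> cA GA D; apply; split. Qed.

Lemma lie_generated_gen (G : set 'End(V)) D : G D -> lie_generated G D.
Proof. by move=> GD A [_]; apply. Qed.

Lemma lie_generated_closed (G : set 'End(V)) : lie_closed (lie_generated G).
Proof.
split; first split=> [A [[[A0 _] _] _] //|c D E hD hE A cA].
  by case: (cA) => -[[_ AL] _] _; apply: AL; [apply: hD|apply: hE].
move=> D E hD hE A cA.
by case: (cA) => -[_ AL] _; apply: AL; [apply: hD|apply: hE].
Qed.

Lemma lin_closedZ (A : set V) c D : lin_closed A -> A D -> A (c *: D).
Proof. by move=> [A0 AL] AD; rewrite -[_ *: _]addr0; apply: AL. Qed.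

Lemma lin_closedD (A : set V) D E : lin_closed A -> A D -> A E -> A (D + E).
Proof. by move=> [A0 AL] AD AE; rewrite -[D]scale1r; apply: AL. Qed.

Lemma lin_closedN (A : set V) D : lin_closed A -> A D -> A (- D).
Proof. by move=> cA AD; rewrite -scaleN1r; apply: lin_closedZ. Qed.

Lemma lin_closed_sum (A : set V) (I : finType) (f : I -> V) : lin_closed A ->
  (forall i, A (f i)) -> A (\sum_i f i).
Proof.
move=> cA Af; elim/big_ind: _ => //; first by case: cA.
by move=> x y Ax Ay; apply: lin_closedD.
Qed.

Lemma lin_closedZV (A : set V) c D : lin_closed A -> c != 0 -> A (c *: D) -> A D.
Proof.
move=> cA c0 AD; rewrite -[D]scale1r -(mulVf c0) -scalerA.
exact: lin_closedZ.
Qed.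

End Generated.

(** * The commutator bracket *)
Section LieBracket.
Variables (K : fieldType) (U : vectType K).
Implicit Types (D E X Y : 'End(U)).

Lemma lie_bracketE D E u : lie_bracket D E u = D (E u) - E (D u).
Proof. by rewrite /lie_bracket add_lfunE opp_lfunE !comp_lfunE. Qed.

Lemma lie_bracket_linearr D : linear (lie_bracket D).
Proof.
move=> c X Y; apply/lfunP => u.
rewrite !lie_bracketE [RHS]add_lfunE scale_lfunE !lie_bracketE.
rewrite !add_lfunE !scale_lfunE linearD linearZ /=.
by rewrite scalerBr opprD addrACA.
Qed.

Lemma lie_bracketC D E : lie_bracket E D = - lie_bracket D E.
Proof. by rewrite /lie_bracket opprB. Qed.

Lemma lie_bracket_linearl E : linear (fun D => lie_bracket D E).
Proof.
move=> c X Y; rewrite lie_bracketC lie_bracket_linearr opprD -scalerN.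
by rewrite -!(lie_bracketC E).
Qed.

Lemma lie_bracketxx D : lie_bracket D D = 0.
Proof. exact: subrr. Qed.

Lemma lie_bracket_leibniz D X Y : lie_bracket D (lie_bracket X Y)
  = lie_bracket (lie_bracket D X) Y + lie_bracket X (lie_bracket D Y).
Proof.
have cancel (W : zmodType) (a b c d e f : W) :
    a - b + (- c - - d) = a - e + (- f - - d) + (e - c + (- b - - f)).
  rewrite -!opprD addrACA subrKA -opprD [f - d + _]addrC subrKA !opprB.
  by rewrite addrACA [RHS]addrACA [- c - b]addrC.
apply/lfunP => u; rewrite [RHS]add_lfunE !lie_bracketE !linearB /=.
exact: cancel.
Qed.

End LieBracket.

(** * Quadratic elements of a Clifford algebra commuting with a rotation *)

(** The representation of the Clifford algebra is given by the operators [gam x],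
    for x in a space V with symmetric form [b]; [j] is a skew complex structure on V,
    implemented by the bracket with [J]. *)
Section CliffordInvariants.
Variables (R : numFieldType) (U : vectType R) (V : lmodType R).
Variables (gam : V -> 'End(U)) (b : V -> V -> R).
Implicit Types (x y z w : V) (D E : 'End(U)).

Definition quad x y : 'End(U) := 2^-1 *: lie_bracket (gam x) (gam y).

Definition quadratics : set 'End(U) :=
  lin_span [set D | exists x y, D = quad x y]%classic.

Lemma quadratics_closed : lin_closed quadratics.
Proof. exact: lin_span_closed. Qed.

Hypothesis gam_lin : linear gam.
Hypothesis gam_anticomm : forall x y u,
  gam x (gam y u) + gam y (gam x u) = b x y *: u.

Lemma quadC x y : quad y x = - quad x y.
Proof. by rewrite /quad lie_bracketC scalerN. Qed.

Lemma quad_linearr x : linear (quad x).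
Proof.
move=> c y z; rewrite /quad gam_lin lie_bracket_linearr.
by rewrite scalerDr !scalerA mulrC.
Qed.

Lemma quad_linearl y : linear (fun x => quad x y).
Proof. by move=> c x z; rewrite quadC quad_linearr opprD -scalerN -!(quadC y). Qed.

(** Quadratic elements act on V by infinitesimal rotations for [b]. *)
Lemma quad_gam x y z :
  lie_bracket (quad x y) (gam z) = gam (b y z *: x - b x z *: y).
Proof.
(* move z to the left through x and y; the terms starting with z cancel *)
have swap p q u : gam p (gam q u) = b p q *: u - gam q (gam p u).
  by rewrite -gam_anticomm addrK.
rewrite (linear_mapB gam_lin) !(linear_mapZ gam_lin).
rewrite /quad (linear_mapZ (lie_bracket_linearl _)).
apply: (@scalerI _ _ 2); first by rewrite pnatr_eq0.
rewrite scalerA divff ?pnatr_eq0 // scale1r; apply/lfunP => u.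
rewrite !lie_bracketE [RHS]scale_lfunE [in RHS]add_lfunE opp_lfunE !scale_lfunE !linearB /=.
rewrite !(swap _ z) !linearB !linearZ /= !(swap _ z).
rewrite !scalerN [in RHS]scalerA mulrC -scalerA -scalerBr scaler_nat mulr2n.
have collect (W : zmodType) (p q c d : W) :
    p - (q - c) + (- q - - (p - d)) + (- c - - d) = (p - q) + (p - q).
  have -> : p - (q - c) = p - q + c by rewrite opprB addrA addrAC.
  have -> : - q - - (p - d) = p - q - d by rewrite opprK addrA [- q + p]addrC.
  by rewrite opprK [- c + d]addrC [p - q + c + _]addrACA -[LHS]addrA subrKA subrr addr0.
exact: collect.
Qed.

Lemma quad_orthogonal x y : b x y = 0 -> quad x y = (gam x \o gam y)%VF.
Proof.
move=> bxy; apply/lfunP => u; rewrite /quad scale_lfunE lie_bracketE comp_lfunE.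
have /eqP := gam_anticomm x y u; rewrite bxy scale0r addrC addr_eq0 => /eqP ->.
by rewrite opprK -mulr2n -scaler_nat scalerA mulVf ?scale1r // pnatr_eq0.
Qed.

Variables (j : V -> V) (J : 'End(U)).
Hypothesis j_lin : linear j.
Hypothesis J_gam : forall x, lie_bracket J (gam x) = gam (j x).
Hypothesis jj : forall x, j (j x) = - x.
Hypothesis b_linl : forall y, linear (b^~ y : V -> R^o).
Hypothesis b_sym : forall x y, b x y = b y x.
Hypothesis b_j : forall x y, b (j x) y = - b x (j y).

Let br_linl E := lie_bracket_linearl E.
Let br_linr D := lie_bracket_linearr D.

Lemma bracket_quad D (d : V -> V) : (forall x, lie_bracket D (gam x) = gam (d x)) ->
  forall x y, lie_bracket D (quad x y) = quad (d x) y + quad x (d y).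
Proof.
move=> Dd x y; rewrite /quad (linear_mapZ (br_linr D)) lie_bracket_leibniz.
by rewrite !Dd scalerDr.
Qed.

Lemma quadratics_act D : quadratics D ->
  exists d : V -> V, forall x, lie_bracket D (gam x) = gam (d x).
Proof.
apply: (@lin_spanW _ _ _ (fun D => exists d : V -> V,
  forall x, lie_bracket D (gam x) = gam (d x))).
  split=> [|c E E' [d Ed] [d' Ed']].
    by exists (fun=> 0) => x; rewrite (linear_map0 (br_linl _)) (linear_map0 gam_lin).
  by exists (fun x => c *: d x + d' x) => x; rewrite br_linl Ed Ed' gam_lin.
by move=> _ [x [y ->]]; exists (fun z => b y z *: x - b x z *: y) => z; exact: quad_gam.
Qed.

(** The bracket with a quadratic element is a derivation preserving V, so it
    preserves the space of commutators of elements of V. *)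
Lemma quadratics_bracket D E : quadratics D -> quadratics E ->
  quadratics (lie_bracket D E).
Proof.
move=> qD; have [d Dd] := quadratics_act qD.
have cQ := quadratics_closed.
apply: (@lin_spanW _ _ _ (fun E => quadratics (lie_bracket D E))).
  split=> [|c X Y hX hY]; first by rewrite (linear_map0 (br_linr _)); exact: cQ.1.
  by rewrite br_linr; exact: cQ.2.
move=> _ [x [y ->]]; rewrite (bracket_quad Dd).
by apply: (lin_closedD cQ); apply: lin_span_gen; do 2!eexists.
Qed.

(** Twice the projection of [quad x y] to the commutant of [J].  As a function of x
    and y it behaves like the imaginary part of a Hermitian form: it is alternating
    and invariant under [j]. *)
Definition hquad x y : 'End(U) := quad x y + quad (j x) (j y).

Lemma hquad_quadratic x y : quadratics (hquad x y).
Proof.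
by apply: (lin_closedD quadratics_closed); apply: lin_span_gen; do 2!eexists.
Qed.

Lemma hquadC x y : hquad y x = - hquad x y.
Proof. by rewrite /hquad quadC [quad (j y) _]quadC opprD. Qed.

Lemma hquad_linearr x : linear (hquad x).
Proof.
by move=> c y z; rewrite /hquad j_lin !quad_linearr scalerDr addrACA.
Qed.

Lemma hquad_linearl y : linear (fun x => hquad x y).
Proof. by move=> c x z; rewrite hquadC hquad_linearr opprD -scalerN -!(hquadC y). Qed.

Lemma quad_oppl x y : quad (- x) y = - quad x y.
Proof. exact: (linear_mapN (quad_linearl y)). Qed.

Lemma quad_oppr x y : quad x (- y) = - quad x y.
Proof. exact: (linear_mapN (quad_linearr x)). Qed.

Lemma hquad_jj x y : hquad (j x) (j y) = hquad x y.
Proof. by rewrite /hquad !jj quad_oppl quad_oppr opprK addrC. Qed.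

Lemma hquad_jl x y : hquad (j x) y = - hquad x (j y).
Proof.
rewrite -[in RHS]hquad_jj jj (linear_mapN (hquad_linearr _)) opprK //.
Qed.

Lemma hquad_orthogonal x y : b x y = 0 ->
  hquad x y = (gam x \o gam y)%VF + (gam (j x) \o gam (j y))%VF.
Proof.
move=> bxy; rewrite /hquad !quad_orthogonal // b_j jj.
by rewrite b_sym (linear_mapN (b_linl _)) opprK b_sym.
Qed.

Lemma hquad_rotated x : hquad x (j x) = 2 *: quad x (j x).
Proof.
by rewrite /hquad jj quad_oppr [quad (j x) x]quadC opprK scaler_nat mulr2n.
Qed.

Lemma hquad_invariant x y : lie_bracket J (hquad x y) = 0.
Proof.
rewrite (linear_mapD (br_linr J)) !(bracket_quad J_gam) !jj quad_oppl quad_oppr.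
by rewrite -opprD [quad x (j y) + _]addrC subrr.
Qed.

(** The operator 1 + 1/4 (ad J)^2 is the projection from quadratic elements to
    invariant ones; it fixes D and sends [quad x y] to half of [hquad x y]. *)
Lemma invariant_hquad (S : set 'End(U)) : lin_closed S ->
  (forall x y, S (hquad x y)) ->
  forall D, quadratics D -> lie_bracket J D = 0 -> S D.
Proof.
move=> cS SH D qD JD.
suff : S (D + 4^-1 *: lie_bracket J (lie_bracket J D)).
  by rewrite JD (linear_map0 (br_linr J)) scaler0 addr0.
move: D qD {JD}; apply: lin_spanW.
  split=> [|c D E hD hE].
    by rewrite !(linear_map0 (br_linr J)) scaler0 addr0; case: cS.
  have := cS.2 c _ _ hD hE; congr (S _).
  by rewrite !br_linr !scalerDr !scalerA [4^-1 * c]mulrC addrACA.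
move=> _ [x [y ->]].
rewrite !(bracket_quad J_gam) (linear_mapD (br_linr J)) !(bracket_quad J_gam).
rewrite !jj quad_oppl quad_oppr.
suff -> : quad x y + 4^-1 *: (- quad x y + quad (j x) (j y) + (quad (j x) (j y) - quad x y))
    = 2^-1 *: hquad x y by apply: lin_closedZ.
rewrite [_ - quad x y]addrC -mulr2n -scaler_nat scalerA.
have -> : 4^-1 * 2 = 2^-1 :> R by field.
rewrite /hquad !scalerDr scalerN addrA; congr (_ + _).
by rewrite -[X in X - _]scale1r -scalerBl; congr (_ *: _); field.
Qed.

(** The endomorphism of V induced by [hquad x y]; it commutes with [j], so it is a
    complex linear map of rank at most two. *)
Definition hact x y z : V :=
  b y z *: x - b x z *: y + b (j y) z *: j x - b (j x) z *: j y.

Lemma hquad_gam x y z : lie_bracket (hquad x y) (gam z) = gam (hact x y z).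
Proof.
rewrite (linear_mapD (br_linl _)) !quad_gam -(linear_mapD gam_lin).
by rewrite addrA.
Qed.

Lemma hact_j x y z : hact x y (j z) = j (hact x y z).
Proof.
have b_j' t s : b t (j s) = - b (j t) s by rewrite b_j opprK.
have b_oppl t s : b (- t) s = - b t s by exact: (linear_mapN (b_linl s)).
rewrite /hact !(linear_mapB j_lin, linear_mapD j_lin, linear_mapZ j_lin) !jj.
rewrite !b_j' !jj !b_oppl !scalerN !scaleNr !opprK.
by rewrite -[LHS]addrA [LHS]addrC [LHS]addrA.
Qed.

Lemma bracket_hquad x y z w : lie_bracket (hquad x y) (hquad z w)
  = hquad (hact x y z) w + hquad z (hact x y w).
Proof.
rewrite [hquad z w]/hquad (linear_mapD (br_linr _)) !(bracket_quad (hquad_gam x y)).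
by rewrite !hact_j addrACA.
Qed.

Variable tr : 'End(U) -> R.
Hypothesis tr_lin : linear (tr : 'End(U) -> R^o).
Hypothesis trC : forall D E, tr (D \o E)%VF = tr (E \o D)%VF.

Lemma tr_bracket A B C :
  tr (lie_bracket A B \o C)%VF = tr (A \o lie_bracket B C)%VF.
Proof.
rewrite /lie_bracket comp_lfunDl comp_lfunDr comp_lfunNl comp_lfunNr.
rewrite !(linear_mapB tr_lin) -!comp_lfunA; congr (_ - _).
by rewrite trC -comp_lfunA.
Qed.

Lemma tr_gam2 x y : tr (gam x \o gam y)%VF = 2^-1 * b x y * tr \1%VF.
Proof.
have : tr ((gam x \o gam y)%VF + (gam y \o gam x)%VF) = b x y * tr \1%VF.
  have -> : ((gam x \o gam y)%VF + (gam y \o gam x)%VF) = b x y *: \1%VF.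
    apply/lfunP => u; rewrite add_lfunE !comp_lfunE scale_lfunE id_lfunE.
    exact: gam_anticomm.
  exact: (linear_mapZ tr_lin).
have -> : tr ((gam x \o gam y)%VF + (gam y \o gam x)%VF) = 2 * tr (gam x \o gam y)%VF.
  by rewrite [LHS](linear_mapD tr_lin) [X in _ + X]trC -[LHS]mulr2n mulr_natl.
by rewrite -mulrA => <-; rewrite mulrA mulVf ?pnatr_eq0 // mul1r.
Qed.

(** The invariant pairing with [J]: a Lie algebra character of the commutant of [J],
    since tr (J [D, E]) = tr ([J, D] E). *)
Definition J_trace D := tr (J \o D)%VF.

Lemma J_trace_linear : linear (J_trace : 'End(U) -> R^o).
Proof.
by move=> c D E; rewrite /J_trace comp_lfunDr -comp_lfunZr tr_lin.
Qed.

Lemma J_trace_bracket D E : lie_bracket J D = 0 -> J_trace (lie_bracket D E) = 0.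
Proof.
by move=> JD; rewrite /J_trace -tr_bracket JD comp_lfun0l (linear_map0 tr_lin).
Qed.

(** Invariance moves [J] onto x: tr (J [x, y]) = tr ([J, x] y) = tr ((j x) y), and
    the trace of a product of two elements of V is half their Clifford pairing. *)
Lemma J_trace_quad x y : J_trace (quad x y) = 4^-1 * b (j x) y * tr \1%VF.
Proof.
rewrite (linear_mapZ J_trace_linear).
rewrite /J_trace -tr_bracket J_gam tr_gam2.
rewrite -[LHS]/(_ * _) !mulrA; congr (_ * _ * _).
by field.
Qed.

Lemma J_trace_hquad x y : J_trace (hquad x y) = 2^-1 * b (j x) y * tr \1%VF.
Proof.
rewrite (linear_mapD J_trace_linear) !J_trace_quad jj [b (- x) _](linear_mapN (b_linl _)).
rewrite -[- b x (j y)]/(- _) -b_j; by field.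
Qed.

Hypothesis tr1_neq0 : tr \1%VF != 0.

(** From here on V has a polarization: isotropic vectors e_i and f_i in duality
    which, with their images under j, span V. *)
Variables (m : nat) (e f : 'I_m -> V).
Hypothesis m_gt2 : (2 < m)%N.
Hypothesis b_ee : forall i k, b (e i) (e k) = 0.
Hypothesis b_ff : forall i k, b (f i) (f k) = 0.
Hypothesis b_ef : forall i k, b (e i) (f k) = (i == k)%:R.
Hypothesis b_eje : forall i k, b (e i) (j (e k)) = 0.
Hypothesis b_fjf : forall i k, b (f i) (j (f k)) = 0.
Hypothesis b_ejf : forall i k, b (e i) (j (f k)) = 0.
Hypothesis ef_span : forall P : V -> Prop,
  (forall c x y, P x -> P y -> P (c *: x + y)) -> (forall x, P x -> P (j x)) ->
  (forall i, P (e i)) -> (forall i, P (f i)) -> forall x, P x.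
Hypothesis J_sum : J = \sum_i hquad (j (e i)) (f i).

Lemma b_fe i k : b (f i) (e k) = (k == i)%:R.
Proof. by rewrite b_sym b_ef. Qed.

Lemma b_fje i k : b (f i) (j (e k)) = 0.
Proof. by apply/eqP; rewrite b_sym b_j b_ejf oppr0. Qed.

Lemma b_oppr x y : b x (- y) = - b x y.
Proof. by rewrite b_sym [b (- y) x](linear_mapN (b_linl x)) b_sym. Qed.

Lemma b_oppl x y : b (- x) y = - b x y.
Proof. exact: (linear_mapN (b_linl y)). Qed.

Let bE := (b_oppl, b_oppr, b_j, jj, b_ee, b_ff, b_ef, b_fe, b_eje, b_fjf, b_ejf, b_fje).

(** The elements [hquad x y] span the unitary Lie algebra of V for the complex
    structure j.  Brackets of the four families below give all the off-diagonal
    elements, in the complex basis of the e_i and f_i, and the traceless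
    combinations of diagonal ones. *)
Section Subalgebra.
Variable L : set 'End(U).
Hypothesis cL : lie_closed L.
Hypothesis L_ee : forall i k, i != k -> L (hquad (e i) (e k)).
Hypothesis L_ff : forall i k, i != k -> L (hquad (f i) (f k)).
Hypothesis L_eje : forall i, L (hquad (e i) (j (e i))).
Hypothesis L_fjf : forall i, L (hquad (f i) (j (f i))).

Let lL : lin_closed L := cL.1.

Let simp := (@oppr0, @opprK, @scale0r, @scaler0, @scaleNr, @scalerN, @scale1r,
  @add0r, @addr0, @sub0r, @subr0).

Let hquadZl c x y : hquad (c *: x) y = c *: hquad x y.
Proof. exact: (linear_mapZ (hquad_linearl y)). Qed.
Let hquadZr c x y : hquad x (c *: y) = c *: hquad x y.
Proof. exact: (linear_mapZ (hquad_linearr x)). Qed.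
Let hquadNl x y : hquad (- x) y = - hquad x y.
Proof. exact: (linear_mapN (hquad_linearl y)). Qed.
Let hquadNr x y : hquad x (- y) = - hquad x y.
Proof. exact: (linear_mapN (hquad_linearr x)). Qed.
Let hquad0l y : hquad 0 y = 0.
Proof. exact: (linear_map0 (hquad_linearl y)). Qed.
Let hquad0r x : hquad x 0 = 0.
Proof. exact: (linear_map0 (hquad_linearr x)). Qed.
Let jN x : j (- x) = - j x. Proof. exact: (linear_mapN j_lin). Qed.
Let jZ c x : j (c *: x) = c *: j x. Proof. exact: (linear_mapZ j_lin). Qed.
Let j0 : j 0 = 0. Proof. exact: (linear_map0 j_lin). Qed.
Let hE := (hquadZl, hquadZr, hquadNl, hquadNr, hquad0l, hquad0r, jN, jZ, j0, jj).

Lemma hact_eje i : hact (e i) (j (e i)) (f i) = (- 2) *: j (e i).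
Proof. by rewrite /hact !bE eqxx !simp -opprD -mulr2n scaler_nat. Qed.

Lemma sub_ef_same i : L (hquad (e i) (f i)).
Proof.
have := cL.2 _ _ (L_eje i) (L_fjf i).
rewrite bracket_hquad hact_j hact_eje !hE hquad_jj [hquad (f i) _]hquadC !simp.
rewrite -opprD -scalerDl => /(lin_closedN lL); rewrite opprK.
by apply: lin_closedZV => //; rewrite -natrD pnatr_eq0.
Qed.

(** The element [hquad (e i) (f k)], which takes e_k to e_i, is obtained by passing
    through a third index l, as e_k |-> f_l |-> e_i. *)
Lemma third_index (i k : 'I_m) : exists l, (l != i) && (l != k).
Proof.
case: (pickP (fun l => (l != i) && (l != k))) => [l hl|none]; first by exists l.
have : (#|'I_m| <= #|[set i; k]%SET|)%N.
  apply/subset_leq_card/fintype.subsetP => l _; rewrite !inE.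
  by have := none l; case: eqP => //= _; case: eqP.
by rewrite card_ord cards2 leqNgt (leq_ltn_trans _ m_gt2) // ltnS leq_b1.
Qed.

Lemma sub_ef i k : i != k -> L (hquad (e i) (f k)).
Proof.
move=> ik; have [l /andP[li lk]] := third_index i k.
have il : i != l by rewrite eq_sym.
have := cL.2 _ _ (L_ee il) (L_ff lk).
by rewrite bracket_hquad /hact !bE eqxx (negPf ik) (negPf il) (negPf lk) !simp !hE !simp.
Qed.

Lemma sub_jef i k : i != k -> L (hquad (j (e i)) (f k)).
Proof.
move=> ik; have := cL.2 _ _ (L_eje i) (L_ff ik).
rewrite bracket_hquad hact_eje /hact !bE (negPf ik) !simp !hE !simp.
by move/(lin_closedN lL); rewrite opprK; apply: lin_closedZV => //; rewrite pnatr_eq0.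
Qed.

(** A bracket of opposite off-diagonal elements.  Separately, the two terms induce
    maps of V with a nonzero trace over the complex numbers, as no bracket does. *)
Lemma sub_jef_diff i k : L (hquad (j (e i)) (f i) - hquad (j (e k)) (f k)).
Proof.
have [->|ik] := eqVneq i k; first by rewrite subrr; case: lL.
have ki : k != i by rewrite eq_sym.
have := cL.2 _ _ (sub_jef ik) (sub_ef ki).
rewrite bracket_hquad /hact !bE !eqxx !simp.
by rewrite [hquad (j (e k)) _]hquad_jl opprK.
Qed.

Lemma sub_eje i k : i != k -> L (hquad (e i) (j (e k))).
Proof.
move=> ik; have := cL.2 _ _ (sub_ef ik) (L_eje k).
rewrite bracket_hquad hact_j /hact !bE eqxx !simp.
have -> : hquad (e k) (j (e i)) = hquad (e i) (j (e k)).
  by rewrite hquadC hquad_jl opprK.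
by rewrite -mulr2n -scaler_nat; apply: lin_closedZV => //; rewrite pnatr_eq0.
Qed.

Lemma sub_fjf i k : i != k -> L (hquad (f i) (j (f k))).
Proof.
rewrite eq_sym => ki; have := cL.2 _ _ (sub_ef ki) (L_fjf k).
rewrite bracket_hquad hact_j /hact !bE eqxx !simp !hE.
have -> : hquad (f k) (j (f i)) = hquad (f i) (j (f k)).
  by rewrite hquadC hquad_jl opprK.
rewrite -opprD => /(lin_closedN lL); rewrite opprK.
by rewrite -mulr2n -scaler_nat; apply: lin_closedZV => //; rewrite pnatr_eq0.
Qed.

Variable S : set 'End(U).
Hypothesis lS : lin_closed S.
Hypothesis LS : forall D, L D -> S D.
Hypothesis SJ : S J.

(** Since [J] is the sum of the diagonal elements, it supplies the missing
    trace part: m times one of them is J plus a sum of differences. *)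
Lemma extension_jef i k : S (hquad (j (e i)) (f k)).
Proof.
have [<-{k}|ik] := eqVneq i k; last exact/LS/sub_jef.
have : S (J + \sum_k (hquad (j (e i)) (f i) - hquad (j (e k)) (f k))).
  apply: (lin_closedD lS SJ); elim/big_ind: _ => [|D E|k _]; first by case: lS.
    exact: lin_closedD.
  exact/LS/sub_jef_diff.
rewrite sumrB -J_sum addrC subrK sumr_const card_ord -scaler_nat.
by apply: lin_closedZV => //; rewrite pnatr_eq0 -lt0n (ltn_trans _ m_gt2).
Qed.

(** The symmetries of [hquad] in x, y and [j] leave only pairs of basis vectors of
    which at most the second is rotated. *)
Lemma hquad_in_extension x y : S (hquad x y).
Proof.
have S0 : S 0 by case: lS.
have hxx z : hquad z z = 0.
  apply/eqP; have : hquad z z == - hquad z z by rewrite -hquadC.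
  by rewrite -subr_eq0 opprK -mulr2n -scaler_nat scaler_eq0 pnatr_eq0.
have Sjl z w : S (hquad z (j w)) -> S (hquad (j z) w).
  by move=> h; rewrite hquad_jl; apply: lin_closedN.
have Sjr z w : S (hquad (j z) w) -> S (hquad z (j w)).
  by move=> h; rewrite -[hquad _ _]opprK -hquad_jl; apply: lin_closedN.
have SC z w : S (hquad z w) -> S (hquad w z).
  by move=> h; rewrite hquadC; apply: lin_closedN.
have Sjj z w : S (hquad z w) -> S (hquad z (j (j w))).
  by move=> h; rewrite jj hquadNr; apply: lin_closedN.
have Sef i k : S (hquad (e i) (f k)) by have [<-|ik] := eqVneq i k;
  [exact/LS/sub_ef_same|exact/LS/sub_ef].
have Sejf i k : S (hquad (e i) (j (f k))) by apply/Sjr/extension_jef.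
have See i k : S (hquad (e i) (e k)) by have [<-|ik] := eqVneq i k;
  [rewrite hxx|exact/LS/L_ee].
have Seje i k : S (hquad (e i) (j (e k))) by have [<-|ik] := eqVneq i k;
  [exact/LS/L_eje|exact/LS/sub_eje].
have Sff i k : S (hquad (f i) (f k)) by have [<-|ik] := eqVneq i k;
  [rewrite hxx|exact/LS/L_ff].
have Sfjf i k : S (hquad (f i) (j (f k))) by have [<-|ik] := eqVneq i k;
  [exact/LS/L_fjf|exact/LS/sub_fjf].
(* for fixed z, it is enough to know the pairs of z with a basis vector or its rotation *)
have extend z : (forall k, S (hquad z (e k)) /\ S (hquad z (j (e k)))) ->
    (forall k, S (hquad z (f k)) /\ S (hquad z (j (f k)))) -> forall w, S (hquad z w).
  move=> he hf w; suff [] : S (hquad z w) /\ S (hquad z (j w)) by [].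
  elim/ef_span: w => // [c w w' [h1 h2] [h1' h2']|w [h1 h2]].
    by split; rewrite ?j_lin hquad_linearr; exact: lS.2.
  by split=> //; apply: Sjj.
move: y; elim/ef_span: x => [c x x' hx hx' y|x hx y|i|i].
- by rewrite hquad_linearl; exact: lS.2.
- exact/Sjl.
- by apply: extend => k; split.
- by apply: extend => k; split=> //; apply: SC => //; apply: Sjl.
Qed.

End Subalgebra.

Variable G : set 'End(U).
Hypothesis G_hquad : forall D, G D ->
  exists c x y, D = c *: hquad x y /\ b (j x) y = 0.
Hypothesis G_ee : forall i k, i != k -> lie_generated G (hquad (e i) (e k)).
Hypothesis G_ff : forall i k, i != k -> lie_generated G (hquad (f i) (f k)).
Hypothesis G_eje : forall i, lie_generated G (hquad (e i) (j (e i))).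
Hypothesis G_fjf : forall i, lie_generated G (hquad (f i) (j (f i))).

(** The three conditions define a Lie subalgebra: on the commutant of [J] the
    functional [J_trace] vanishes on brackets. *)
Lemma lie_generated_sub D : lie_generated G D ->
  [/\ quadratics D, lie_bracket J D = 0 & J_trace D = 0].
Proof.
apply: (@lie_generatedW _ _ _ (fun D =>
  [/\ quadratics D, lie_bracket J D = 0 & J_trace D = 0])).
  split; first split.
  - split; [exact: quadratics_closed.1|by rewrite (linear_map0 (br_linr _))|].
    exact: (linear_map0 J_trace_linear).
  - move=> c X Y [qX JX tX] [qY JY tY]; split; first exact: quadratics_closed.2.
      by rewrite br_linr JX JY scaler0 addr0.
    by rewrite [LHS]J_trace_linear tX tY scaler0 addr0.
  - move=> X Y [qX JX tX] [qY JY tY]; split; first exact: quadratics_bracket.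
      by rewrite lie_bracket_leibniz JX JY (linear_map0 (br_linl _))
        (linear_map0 (br_linr _)) addr0.
    exact: J_trace_bracket.
move=> X /G_hquad[c [x [y [-> bjxy]]]]; split.
- exact: (lin_closedZ _ quadratics_closed (hquad_quadratic _ _)).
- by rewrite (linear_mapZ (br_linr _)) hquad_invariant scaler0.
- by rewrite [LHS](linear_mapZ J_trace_linear) J_trace_hquad bjxy mulr0 mul0r [LHS]mulr0.
Qed.

(** The value of [J_trace] at [J] is - m / 2 times the trace of the identity. *)
Lemma generated_multiple_of_J c : lie_generated G (c *: J) -> c = 0.
Proof.
have JJ : J_trace J = \sum_(i < m) (- 2^-1 * tr \1%VF).
  rewrite J_sum; transitivity (\sum_i J_trace (hquad (j (e i)) (f i))).
    exact: (linear_map_sum J_trace_linear).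
  by apply: eq_bigr => i _; rewrite J_trace_hquad jj b_oppl b_ef eqxx mulrN1.
case/lie_generated_sub=> _ _; rewrite (_ : J_trace _ = c * J_trace J); last first.
  exact: (linear_mapZ J_trace_linear).
move/eqP; rewrite mulf_eq0 => /orP[/eqP //|].
rewrite JJ sumr_const card_ord -[_ *+ m]mulr_natl !mulf_eq0 (negPf tr1_neq0) oppr_eq0.
by rewrite invr_eq0 !pnatr_eq0 -leqn0 leqNgt (ltn_trans _ m_gt2).
Qed.

Lemma generated_plus_J D :
  (exists E c, lie_generated G E /\ D = E + c *: J) <->
  quadratics D /\ lie_bracket J D = 0.
Proof.
have JJ : quadratics J.
  rewrite J_sum; elim/big_ind: _ => [|X Y hX hY|i _]; last exact: hquad_quadratic.
    exact: quadratics_closed.1.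
  exact: (lin_closedD quadratics_closed).
split=> [[E [c [/lie_generated_sub[qE JE _] ->]]]|[qD JD]].
  split; last by rewrite addrC br_linr lie_bracketxx scaler0 add0r.
  by rewrite addrC; exact: quadratics_closed.2.
have cL := lie_generated_closed G.
pose S : set 'End(U) := fun D => exists E c, lie_generated G E /\ D = E + c *: J.
have lS : lin_closed S.
  split; first by exists 0, 0; split; [exact: cL.1.1|rewrite scale0r addr0].
  move=> c X Y [E [d [hE ->]]] [E' [d' [hE' ->]]]; exists (c *: E + E'), (c * d + d').
  split; first exact: cL.1.2.
  by rewrite scalerDr scalerDl scalerA addrACA.
apply: (invariant_hquad lS) => //; apply: (hquad_in_extension cL) => //.
  by move=> E hE; exists E, 0; rewrite scale0r addr0.
by exists 0, 1; split; [exact: cL.1.1|rewrite scale1r add0r].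
Qed.

End CliffordInvariants.

(** * The trace of operators on forms *)
Section Trace.
Variables (R : numFieldType) (n : nat).
Implicit Types (D E : 'End(ext R n)).

Definition ext_tr D : R := \sum_(S : {set 'I_n}) D (ext_basis R S) S.

Lemma ext_tr_linear : linear (ext_tr : 'End(ext R n) -> R^o).
Proof.
move=> c D E; rewrite /ext_tr scaler_sumr -big_split /=.
by apply: eq_bigr => S _; rewrite add_lfunE scale_lfunE !ffunE.
Qed.

Lemma ext_trC D E : ext_tr (D \o E)%VF = ext_tr (E \o D)%VF.
Proof.
have expand (A B : 'End(ext R n)) : ext_tr (A \o B)%VF =
    \sum_S \sum_T B (ext_basis R S) T * A (ext_basis R T) S.
  apply: eq_bigr => S _; rewrite comp_lfunE {1}(ext_basis_sum (B _)) linear_sum /=.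
  by rewrite sum_ffunE; apply: eq_bigr => T _; rewrite linearZ /= !ffunE.
rewrite !expand exchange_big /=; apply: eq_bigr => S _; apply: eq_bigr => T _.
exact: mulrC.
Qed.

Lemma ext_tr1_neq0 : ext_tr \1%VF != 0.
Proof.
rewrite /ext_tr; under eq_bigr do rewrite id_lfunE ffunE eqxx.
rewrite sumr_const pnatr_eq0 -lt0n; apply/card_gt0P.
by exists set0.
Qed.

End Trace.

(** * Real and imaginary parts of operators on complex forms *)

(** Several identities below are obtained by composing explicit equalities instead
    of rewriting: the pattern [cpair D E phi S] would be compared with the real
    coefficients [D phi S] by unfolding the complex numbers. *)
Section ComplexOperators.
Variables (R : realType) (n : nat).
Implicit Types (D E : 'End(ext R n)) (phi psi : ext R[i] n) (U : set 'End(ext R n)).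

Definition ext_re phi : ext R n := [ffun S => complex.Re (phi S)].
Definition ext_im phi : ext R n := [ffun S => complex.Im (phi S)].

Lemma ext_re_lin c phi psi : ext_re (c *: phi + psi)
  = complex.Re c *: ext_re phi - complex.Im c *: ext_im phi + ext_re psi.
Proof.
apply/ffunP => S; rewrite !ffunE /GRing.scale /=.
by case: c => a b; case: (phi S) => ? ?; case: (psi S).
Qed.

Lemma ext_im_lin c phi psi : ext_im (c *: phi + psi)
  = complex.Im c *: ext_re phi + complex.Re c *: ext_im phi + ext_im psi.
Proof.
apply/ffunP => S; rewrite !ffunE /GRing.scale /=.
by case: c => a b; case: (phi S) => ? ?; case: (psi S) => ? ? /=; rewrite [X in X + _]addrC.
Qed.

Fact cplx_fun_linear D : linear (fun phi : ext R[i] n =>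
    [ffun S => Complex (D (ext_re phi) S) (D (ext_im phi) S)] : ext R[i] n).
Proof.
move=> c phi psi; apply/ffunP => S; rewrite !ffunE ext_re_lin ext_im_lin.
rewrite !linearD !linearN !linearZ /= !ffunE; case: c => a b /=.
by apply/eqP; rewrite eq_complex /GRing.scale /=; apply/andP; split;
  apply/eqP; ring.
Qed.

Lemma cplxE D phi S :
  cplx D phi S = Complex (D (ext_re phi) S) (D (ext_im phi) S).
Proof.
pose f : {linear ext R[i] n -> ext R[i] n} := HB.pack (fun phi : ext R[i] n =>
    [ffun S => Complex (D (ext_re phi) S) (D (ext_im phi) S)] : ext R[i] n)
  (GRing.isLinear.Build _ _ _ _ _ (cplx_fun_linear D)).
by rewrite /cplx (lfunE f) ffunE.
Qed.

Definition cpair D E : 'End(ext R[i] n) := cplx D + Complex 0 1 *: cplx E.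

Lemma cpairE D E phi S : cpair D E phi S
  = Complex (D (ext_re phi) S - E (ext_im phi) S) (D (ext_im phi) S + E (ext_re phi) S).
Proof.
rewrite add_lfunE scale_lfunE !ffunE !cplxE /GRing.scale /=.
by apply/eqP; rewrite eq_complex /=; apply/andP; split; apply/eqP; ring.
Qed.

Lemma cpairP (D E : 'End(ext R n)) (F : 'End(ext R[i] n)) :
  (forall phi S, F phi S = Complex (D (ext_re phi) S - E (ext_im phi) S)
                                   (D (ext_im phi) S + E (ext_re phi) S)) ->
  F = cpair D E.
Proof. by move=> FE; apply/lfunP => phi; apply/ffunP => S; rewrite FE cpairE. Qed.

Lemma cpair_inj D E D' E' : cpair D E = cpair D' E' -> D = D' /\ E = E'.
Proof.
move=> eqc.
have at_real (phi : ext R n) S : D phi S = D' phi S /\ E phi S = E' phi S.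
  pose phiC : ext R[i] n := [ffun S => Complex (phi S) 0].
  have re : ext_re phiC = phi by apply/ffunP => T; rewrite !ffunE.
  have im : ext_im phiC = 0 by apply/ffunP => T; rewrite !ffunE.
  have eqS := congr1 (fun A : 'End(ext R[i] n) => A phiC S) eqc.
  have := etrans (esym (cpairE D E phiC S)) (etrans eqS (cpairE D' E' phiC S)).
  have ap0 (A : 'End(ext R n)) : A 0 S = 0 by rewrite linear0 ffunE.
  rewrite re im !ap0 !subr0 !add0r => eqC; split.
    exact: (congr1 (@complex.Re R) eqC).
  exact: (congr1 (@complex.Im R) eqC).
by split; apply/lfunP => phi; apply/ffunP => S; have [] := at_real phi S.
Qed.

Lemma cplx_cpair D : cplx D = cpair D 0.
Proof.
have ap0 (phi : ext R n) S : (0 : 'End(ext R n)) phi S = 0 by rewrite zero_lfunE ffunE.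
by apply: cpairP => phi S; rewrite !ap0 subr0 addr0 cplxE.
Qed.

Lemma cpair_lin (c : R[i]) D E D' E' : c *: cpair D E + cpair D' E'
  = cpair (complex.Re c *: D - complex.Im c *: E + D')
          (complex.Im c *: D + complex.Re c *: E + E').
Proof.
have linE (K : fieldType) x y z (A B C : 'End(ext K n)) (phi : ext K n) S :
    (x *: A + y *: B + z *: C) phi S = x * A phi S + y * B phi S + z * C phi S.
  by rewrite !add_lfunE !scale_lfunE !ffunE.
apply: cpairP => phi S.
have := linE _ c 1 0 (cpair D E) (cpair D' E') 0 phi S.
rewrite scale1r scale0r addr0 mul1r mul0r addr0 => ->.
have reE (psi : ext R n) : (complex.Re c *: D - complex.Im c *: E + D') psi S
    = complex.Re c * D psi S - complex.Im c * E psi S + D' psi S.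
  by have := linE _ (complex.Re c) (- complex.Im c) 1 D E D' psi S;
    rewrite scaleNr scale1r mulNr mul1r.
have imE (psi : ext R n) : (complex.Im c *: D + complex.Re c *: E + E') psi S
    = complex.Im c * D psi S + complex.Re c * E psi S + E' psi S.
  by have := linE _ (complex.Im c) (complex.Re c) 1 D E E' psi S;
    rewrite scale1r mul1r.
apply: (etrans (congr2 (fun x y => c * x + y) (cpairE D E phi S) (cpairE D' E' phi S))).
rewrite !reE !imE; case: c {reE imE} => a b.
by apply/eqP; rewrite eq_complex /=; apply/andP; split; apply/eqP; ring.
Qed.

Lemma bracket_cpair D E J :
  lie_bracket (cpair D E) (cplx J) = cpair (lie_bracket D J) (lie_bracket E J).
Proof.
have re A phi : ext_re (cplx A phi) = A (ext_re phi).
  by apply/ffunP => S; rewrite ffunE cplxE.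
have im A phi : ext_im (cplx A phi) = A (ext_im phi).
  by apply/ffunP => S; rewrite ffunE cplxE.
have rep A B phi : ext_re (cpair A B phi) = A (ext_re phi) - B (ext_im phi).
  by apply/ffunP => S; rewrite ffunE cpairE !ffunE.
have imp A B phi : ext_im (cpair A B phi) = A (ext_im phi) + B (ext_re phi).
  by apply/ffunP => S; rewrite ffunE cpairE !ffunE.
have brE (K : fieldType) (A B : 'End(ext K n)) (phi : ext K n) S :
    lie_bracket A B phi S = A (B phi) S - B (A phi) S.
  by rewrite lie_bracketE !ffunE.
have subE (A : 'End(ext R n)) x y S : A (x - y) S = A x S - A y S.
  by rewrite linearB !ffunE.
have addE (A : 'End(ext R n)) x y S : A (x + y) S = A x S + A y S.
  by rewrite linearD !ffunE.
apply: cpairP => phi S; apply: (etrans (brE _ (cpair D E) (cplx J) phi S)).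
apply: (etrans (congr2 (fun x y => x - y) (cpairE D E (cplx J phi) S)
  (cplxE J (cpair D E phi) S))).
apply: etrans _ (esym (congr2 (@Complex R)
  (congr2 (fun x y => x - y) (brE _ D J (ext_re phi) S) (brE _ E J (ext_im phi) S))
  (congr2 (fun x y => x + y) (brE _ D J (ext_im phi) S) (brE _ E J (ext_re phi) S)))).
rewrite (re J phi) (im J phi) (rep D E phi) (imp D E phi) (subE J) (addE J).
by apply/eqP; rewrite eq_complex /=; apply/andP; split; apply/eqP; ring.
Qed.

Lemma cpair00 : cpair 0 0 = 0.
Proof.
by apply/esym/cpairP => phi S; rewrite !zero_lfunE !ffunE subr0 addr0.
Qed.

Lemma complexifiedP U F : lin_closed U ->
  complexified U F <-> exists D E, [/\ U D, U E & F = cpair D E].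
Proof.
move=> lU; split=> [|[D [E [UD UE ->]]]].
  move: F; apply: lin_spanW.
    split=> [|c F F' [D [E [UD UE ->]]] [D' [E' [UD' UE' ->]]]].
      have U0 : U 0 by case: lU.
      by exists 0, 0; split=> //; rewrite cpair00.
    rewrite cpair_lin; eexists _, _; split; last by [].
      rewrite -addrA -scaleNr; apply lU => //; exact: lU.2.
    by rewrite -addrA; apply lU => //; exact: lU.2.
  move=> _ [D UD <-]; exists D, 0; split=> //; first by case: lU.
  exact: cplx_cpair.
have lC : lin_closed (complexified U) by exact: lin_span_closed.
rewrite /cpair addrC; apply lC; apply: lin_span_gen.
  by exists E.
by exists D.
Qed.

(** Reduction of the theorem to the reals: since real and imaginary parts of an
    operator are unique, membership and commutation with J may be tested on them
    separately. *)
Lemma complexified_decomposition (L Q : set 'End(ext R n)) (J : 'End(ext R n)) :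
  lin_closed L -> lin_closed Q -> (forall c, L (c *: J) -> c = 0) ->
  (forall D, (exists E c, L E /\ D = E + c *: J) <-> Q D /\ lie_bracket J D = 0) ->
  let JC := [set c *: cplx J | c in [set: R[i]]]%classic in
  (complexified L `&` JC = [set 0] /\
   [set D + E | D in complexified L & E in JC]
     = [set D | complexified Q D /\ lie_bracket D (cplx J) = 0])%classic.
Proof.
move=> lL lQ L_J LJ_Q JC.
have JCE (c : R[i]) : c *: cplx J = cpair (complex.Re c *: J) (complex.Im c *: J).
  have := cpair_lin c J 0 0 0; rewrite -cplx_cpair !scaler0 subr0 !addr0.
  by rewrite cpair00 addr0.
split; apply/seteqP; split=> [F|F].
- move=> [/(complexifiedP _ lL)[D [E [LD LE ->]]] [c _]]; rewrite JCE => /cpair_inj[DJ EJ].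
  rewrite -DJ in LD; rewrite -EJ in LE.
  have cr := L_J _ LD; have ci := L_J _ LE.
  by rewrite -DJ -EJ cr ci !scale0r cpair00.
- move=> ->; split; first by case: (@lin_span_closed _ _ [set cplx D | D in L]%classic).
  by exists 0 => //; rewrite scale0r.
- move=> [_ /(complexifiedP _ lL)[D [E [LD LE ->]]] [_ [c _ <-] <-]].
  have -> : cpair D E + c *: cplx J
      = cpair (D + complex.Re c *: J) (E + complex.Im c *: J).
    have := cpair_lin 1 D E (complex.Re c *: J) (complex.Im c *: J).
    by rewrite !scale1r !scale0r subr0 add0r -JCE.
  have [QD JD] : Q (D + complex.Re c *: J) /\ lie_bracket J (D + complex.Re c *: J) = 0.
    by apply/LJ_Q; exists D, (complex.Re c).
  have [QE JE] : Q (E + complex.Im c *: J) /\ lie_bracket J (E + complex.Im c *: J) = 0.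
    by apply/LJ_Q; exists E, (complex.Im c).
  split.
    apply/(complexifiedP _ lQ).
    by exists (D + complex.Re c *: J), (E + complex.Im c *: J).
  by rewrite bracket_cpair lie_bracketC JD [lie_bracket _ J]lie_bracketC JE oppr0 cpair00.
- move=> [/(complexifiedP _ lQ)[D [E [QD QE ->]]]]; rewrite bracket_cpair.
  rewrite -cpair00 => /cpair_inj[DJ EJ].
  have [D' [a [LD' ->]]] : exists D' c, L D' /\ D = D' + c *: J.
    by apply/LJ_Q; split=> //; rewrite lie_bracketC DJ oppr0.
  have [E' [b [LE' ->]]] : exists E' c, L E' /\ E = E' + c *: J.
    by apply/LJ_Q; split=> //; rewrite lie_bracketC EJ oppr0.
  exists (cpair D' E'); first by apply/(complexifiedP _ lL); exists D', E'.
  exists (Complex a b *: cplx J); first by exists (Complex a b).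
  have := cpair_lin 1 D' E' (a *: J) (b *: J).
  by rewrite JCE !scale1r !scale0r subr0 add0r.
Qed.

End ComplexOperators.

(** * Two-element and three-element index types *)
Section SmallOrdinals.

Lemma ord2_ind (P : 'I_2 -> Prop) : P 0 -> P 1 -> forall i, P i.
Proof.
move=> P0 P1 [[|[|//]] hi].
  by have -> : Ordinal hi = 0 by exact: val_inj.
by have -> : Ordinal hi = 1 by exact: val_inj.
Qed.

Lemma ord3_ind (P : 'I_3 -> Prop) : P 0 -> P 1 -> P 2 -> forall i, P i.
Proof.
move=> P0 P1 P2 [[|[|[|//]]] hi].
- by have -> : Ordinal hi = 0 by exact: val_inj.
- by have -> : Ordinal hi = 1 by exact: val_inj.
- by have -> : Ordinal hi = 2 by exact: val_inj.
Qed.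

Lemma ord3_pairs (P : 'I_3 -> 'I_3 -> Prop) : (forall i k, P i k -> P k i) ->
  P 0 1 -> P 0 2 -> P 1 2 -> forall i k, i != k -> P i k.
Proof.
by move=> sym P01 P02 P12; elim/ord3_ind; elim/ord3_ind => // _; apply: sym.
Qed.

Lemma codom_ord2 (T : Type) (f : 'I_2 -> T) : codom f = [:: f 0; f 1].
Proof.
rewrite /codom /image_mem !enum_ordSl enum_ord0 /=.
by congr [:: f _; f _]; exact: val_inj.
Qed.

Lemma codom_ord0 (T : Type) (f : 'I_0 -> T) : codom f = [::].
Proof. by rewrite /codom /image_mem enum_ord0. Qed.

End SmallOrdinals.

(** * The Clifford action of an adapted coframe *)
Section Coframe.
Variables (R : realType) (n : nat) (g w1 w2 wD : 'M[R]_n).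
Variable v : 'I_2 -> 'I_3 -> 'rV[R]_n.
Hypothesis g_sym : g^T = g.
Hypothesis g_pos : forall u : 'rV[R]_n, u != 0 -> 0 < (u *m g *m u^T) 0 0.
Hypothesis v_adapted : @adapted_coframe R n 2 0 g w1 w2 wD
  (v^~ 0) (v^~ 1) (v^~ 2) (fun=> 0) (fun=> 0).

(** The metric dual of a covector u is the vector [u *m G], so that [codot g u w] is
    the value of w on it and the vectors [v i k *m G] form the basis dual to v. *)
Let G := invmx g.

Lemma metric_unit : g \in unitmx.
Proof.
rewrite -row_free_unit -kermx_eq0; apply/negPn/negP => /rowV0Pn[u /sub_kermxP ug].
by move=> /g_pos; rewrite ug mul0mx mxE ltxx.
Qed.

Lemma codotC u w : codot g u w = codot g w u.
Proof.
rewrite /codot -[in RHS](trmxK (w *m _ *m _)) [RHS]mxE !trmx_mul trmxK.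
by rewrite trmx_inv g_sym mulmxA.
Qed.

Lemma coframe_orthonormal i k j l :
  codot g (v i j) (v k l) = ((i == k) && (j == l))%:R.
Proof.
case: v_adapted => _; rewrite !codom_ord2 !codom_ord0 /= => orth unit _.
move: unit; rewrite andbT; do 5 (case/andP=> /eqP ?); move/eqP=> ?.
move: orth; rewrite !andbT -!andbA.
(* the six covectors satisfy fifteen orthogonality relations *)
do 14 (case/andP=> /eqP ?); move/eqP=> ?.
by elim/ord2_ind: i; elim/ord2_ind: k; elim/ord3_ind: j; elim/ord3_ind: l => //=;
  rewrite codotC.
Qed.

Lemma coframe_span (P : 'rV[R]_n -> Prop) :
  (forall c u w, P u -> P w -> P (c *: u + w)) -> (forall i j, P (v i j)) ->
  forall u, P u.
Proof.
move=> PL Pv u; case: v_adapted => /andP[/eqP span _] _ _ _.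
have P0 : P 0 by rewrite -(addNr (v 0 0)) -scaleN1r; apply: PL.
have : u \in fullv by rewrite memvf.
rewrite -span => /(coord_span (X := in_tuple _)) ->.
elim/big_ind: _ => // [x y Px Py|i _]; first by rewrite -[x]scale1r; apply: PL.
rewrite -[_ *: _]addr0; apply: PL => //.
have memv (w : 'rV[R]_n) (X : seq 'rV[R]_n) : w \in X -> X =
    (codom (v^~ 0) ++ codom (v^~ 1) ++ codom (v^~ 2)) ++
    codom (fun _ : 'I_0 => 0) ++ codom (fun _ : 'I_0 => 0) -> P w.
  move=> wX XE; move: wX; rewrite XE !codom_ord0 !cats0 !mem_cat.
  by case/or3P=> /codomP[k ->].
apply: memv (erefl _); exact: mem_nth.
Qed.

Let V := ('rV[R]_n * 'rV[R]_n)%type.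

Definition pairing (t u : 'rV[R]_n) : R := (t *m u^T) 0 0.

Lemma pairing_linearl u : linear (fun t => pairing t u : R^o).
Proof. by move=> c t s; rewrite /pairing mulmxDl -scalemxAl !mxE. Qed.

Lemma pairing_linearr t : linear (fun u => pairing t u : R^o).
Proof.
by move=> c u w; rewrite /pairing linearD linearZ mulmxDr -scalemxAr !mxE.
Qed.

Definition clif (x : V) : 'End(ext R n) := clifford x.1 x.2.

Definition clif_form (x y : V) : R := pairing x.1 y.2 + pairing y.1 x.2.

Lemma clif_linear : linear clif.
Proof.
move=> c x y; rewrite /clif /clifford -!/(ext_mul _) /= contraction_linearl ext_mul_linear.
by rewrite scalerDr addrACA.
Qed.

Lemma clifE x phi : clif x phi = contraction x.1 phi + ext_mul x.2 phi.
Proof. by rewrite /clif /clifford add_lfunE. Qed.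

Lemma clif_anticomm x y phi :
  clif x (clif y phi) + clif y (clif x phi) = clif_form x y *: phi.
Proof.
rewrite !clifE !linearD /=.
rewrite [LHS](AC ((2*2)*(2*2)) (((1*5)*(4*8))*((7*2)*(6*3)))) /=.
rewrite contraction_anticomm ext_mul_anticomm addr0 add0r.
rewrite [ext_mul y.2 _ + _]addrC !contraction_ext_mul -scalerDl.
by congr (_ *: _); exact: addrC.
Qed.

Lemma clif_form_linearl y : linear (fun x => clif_form x y : R^o).
Proof.
move=> c x z; rewrite /clif_form /= pairing_linearl pairing_linearr.
by rewrite scalerDr addrACA.
Qed.

Lemma clif_form_sym x y : clif_form x y = clif_form y x.
Proof. exact: addrC. Qed.

(** The quarter turn taking v_0i to v_1i and v_1i to - v_0i, and below the same quarter
    turn of the dual basis of vectors. *)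
Definition rot_cov (u : 'rV[R]_n) : 'rV[R]_n :=
  \sum_i (codot g (v 0 i) u *: v 1 i - codot g (v 1 i) u *: v 0 i).

Definition rot_vec (t : 'rV[R]_n) : 'rV[R]_n :=
  \sum_i (pairing t (v 0 i) *: (v 1 i *m G) - pairing t (v 1 i) *: (v 0 i *m G)).

Definition rotate (x : V) : V := (rot_vec x.1, rot_cov x.2).

Lemma rot_cov_linear : linear rot_cov.
Proof.
move=> c u w; rewrite /rot_cov scaler_sumr -big_split /=; apply: eq_bigr => i _.
rewrite -[codot g _ (_ + _)]/(pairing _ _) -[codot g (v 1 i) (_ + _)]/(pairing _ _).
rewrite !pairing_linearr !scalerDl scalerBr !scalerA opprD addrACA.
by [].
Qed.

Lemma rot_vec_linear : linear rot_vec.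
Proof.
move=> c u w; rewrite /rot_vec scaler_sumr -big_split /=; apply: eq_bigr => i _.
by rewrite !pairing_linearl !scalerDl scalerBr !scalerA opprD addrACA.
Qed.

Lemma rotate_linear : linear rotate.
Proof. by move=> c x y; rewrite /rotate /= rot_cov_linear rot_vec_linear. Qed.

Lemma pairing_rot t u : pairing (rot_vec t) u = - pairing t (rot_cov u).
Proof.
rewrite [LHS](linear_map_sum (pairing_linearl u)).
rewrite [in RHS](linear_map_sum (pairing_linearr t)) -sumrN.
apply: eq_bigr => i _.
rewrite [LHS](linear_mapB (pairing_linearl u)) [in RHS](linear_mapB (pairing_linearr t)).
rewrite !(linear_mapZ (pairing_linearl u)) !(linear_mapZ (pairing_linearr t)).
rewrite opprB; congr (_ - _); exact: mulrC.
Qed.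

Lemma clif_form_rotate x y : clif_form (rotate x) y = - clif_form x (rotate y).
Proof.
by rewrite /clif_form /= !pairing_rot opprD opprK.
Qed.

Lemma rot_cov0 i : rot_cov (v 0 i) = v 1 i.
Proof.
rewrite /rot_cov (bigD1 i) //= big1 ?addr0.
  by rewrite !coframe_orthonormal !eqxx /= scale1r scale0r subr0.
by move=> k ki; rewrite !coframe_orthonormal (negPf ki) ?andbF !scale0r subr0.
Qed.

Lemma rot_cov1 i : rot_cov (v 1 i) = - v 0 i.
Proof.
rewrite /rot_cov (bigD1 i) //= big1 ?addr0.
  by rewrite !coframe_orthonormal !eqxx /= scale1r scale0r sub0r.
by move=> k ki; rewrite !coframe_orthonormal (negPf ki) ?andbF !scale0r subr0.
Qed.

(** The rotation commutes with metric duality, as it is an isometry. *)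
Lemma rot_vec_dual u : rot_vec (u *m G) = rot_cov u *m G.
Proof.
rewrite /rot_vec /rot_cov mulmx_suml; apply: eq_bigr => i _.
rewrite mulmxBl -!scalemxAl -![pairing (u *m G) _]/(codot g _ _).
by rewrite codotC [codot g u (v 1 i)]codotC.
Qed.

Lemma rot_cov_rot_cov u : rot_cov (rot_cov u) = - u.
Proof.
elim/coframe_span: u => [c u w hu hw|]; first by rewrite !rot_cov_linear hu hw opprD scalerN.
elim/ord2_ind => i; rewrite ?(rot_cov0, rot_cov1) //.
by rewrite (linear_mapN rot_cov_linear) rot_cov0.
Qed.

Lemma vec_coframe (t : 'rV[R]_n) : t = (t *m g) *m G.
Proof. by rewrite mulmxK ?metric_unit. Qed.

Lemma rotate_rotate x : rotate (rotate x) = - x.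
Proof.
rewrite /rotate /= rot_cov_rot_cov [x.1]vec_coframe !rot_vec_dual rot_cov_rot_cov mulNmx -vec_coframe.
by case: x.
Qed.

(** The expression of J by the coframe.  It is quadratic, and a derivation of
    degree 0 because each summand is one. *)
Definition rotation_op : 'End(ext R n) :=
  \sum_i ((ext_mul (v 1 i) \o contraction (v 0 i *m G))%VF
           - (ext_mul (v 0 i) \o contraction (v 1 i *m G))%VF).

Lemma rotation_op_clif x : lie_bracket rotation_op (clif x) = clif (rotate x).
Proof.
rewrite (linear_map_sum (lie_bracket_linearl (clif x))).
rewrite /clif /clifford -!/(ext_mul _) /=.
rewrite (linear_map_sum (@contraction_linearl R n)) (linear_map_sum (@ext_mul_linear R n)).
rewrite -big_split /=; apply: eq_bigr => i _.
rewrite (linear_mapB (lie_bracket_linearl _)) !(linear_mapD (lie_bracket_linearr _)).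
rewrite !bracket_ext_mul_contraction_contraction !bracket_ext_mul_contraction_mul.
rewrite (linear_mapB (@contraction_linearl R n)) (linear_mapB (@ext_mul_linear R n)).
rewrite !(linear_mapZ (@contraction_linearl R n)) !(linear_mapZ (@ext_mul_linear R n)).
rewrite opprD opprK addrACA; congr (_ + _).
by rewrite addrC.
Qed.

Definition ecov (i : 'I_3) : V := (0, v 0 i).
Definition fvec (i : 'I_3) : V := (v 0 i *m G, 0).

Lemma pairing0l u : pairing 0 u = 0. Proof. exact: (linear_map0 (pairing_linearl u)). Qed.
Lemma pairing0r t : pairing t 0 = 0. Proof. exact: (linear_map0 (pairing_linearr t)). Qed.

Lemma rotate_ecov i : rotate (ecov i) = (0, v 1 i).
Proof. by rewrite /rotate /= rot_cov0 (linear_map0 rot_vec_linear). Qed.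

Lemma rotate_fvec i : rotate (fvec i) = (v 1 i *m G, 0).
Proof. by rewrite /rotate /= rot_vec_dual rot_cov0 (linear_map0 rot_cov_linear). Qed.

Lemma clif_form_ee i k : clif_form (ecov i) (ecov k) = 0.
Proof. by rewrite /clif_form /= !pairing0l addr0. Qed.
Lemma clif_form_ff i k : clif_form (fvec i) (fvec k) = 0.
Proof. by rewrite /clif_form /= !pairing0r addr0. Qed.
Lemma clif_form_ef i k : clif_form (ecov i) (fvec k) = (i == k)%:R.
Proof.
rewrite /clif_form /= pairing0l add0r -[pairing _ _]/(codot g _ _).
by rewrite coframe_orthonormal eq_sym.
Qed.
Lemma clif_form_eje i k : clif_form (ecov i) (rotate (ecov k)) = 0.
Proof. by rewrite rotate_ecov /clif_form /= !pairing0l addr0. Qed.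
Lemma clif_form_fjf i k : clif_form (fvec i) (rotate (fvec k)) = 0.
Proof. by rewrite rotate_fvec /clif_form /= !pairing0r addr0. Qed.
Lemma clif_form_ejf i k : clif_form (ecov i) (rotate (fvec k)) = 0.
Proof.
rewrite rotate_fvec /clif_form /= pairing0l add0r -[pairing _ _]/(codot g _ _).
by rewrite coframe_orthonormal.
Qed.

Lemma clifford_span (P : V -> Prop) :
  (forall c x y, P x -> P y -> P (c *: x + y)) -> (forall x, P x -> P (rotate x)) ->
  (forall i, P (ecov i)) -> (forall i, P (fvec i)) -> forall x, P x.
Proof.
move=> PL Pj Pe Pf.
have Pu u : P (0, u).
  elim/coframe_span: u => [c u w hu hw|].
    by have := PL c _ _ hu hw; congr P; apply: injective_projections;
      rewrite /= ?scaler0 ?addr0.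
  elim/ord2_ind => i; first exact: Pe.
  by rewrite -rotate_ecov; apply: Pj.
have Pt u : P (u *m G, 0).
  elim/coframe_span: u => [c u w hu hw|].
    have := PL c _ _ hu hw; congr P.
    by apply: injective_projections; rewrite /= ?scaler0 ?addr0 // mulmxDl scalemxAl.
  elim/ord2_ind => i; first exact: Pf.
  by rewrite -rotate_fvec; apply: Pj.
move=> [t u]; have := PL 1 _ _ (Pt (t *m g)) (Pu u); congr P.
by apply: injective_projections; rewrite /= ?scaler0 ?addr0 ?add0r ?scale1r -?vec_coframe.
Qed.

Definition coframe_hquad := hquad clif rotate.

Lemma clif_cov u : clif (0, u) = ext_mul u.
Proof.
by rewrite /clif /clifford /= (linear_map0 (@contraction_linearl R n)) add0r.
Qed.

Lemma clif_vec t : clif (t, 0) = contraction t.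
Proof.
rewrite /clif /clifford /= -/(ext_mul 0).
by rewrite (linear_map0 (@ext_mul_linear R n)) addr0.
Qed.

Let coframe_hquad_orthogonal x y : clif_form x y = 0 ->
  coframe_hquad x y = (clif x \o clif y)%VF + (clif (rotate x) \o clif (rotate y))%VF.
Proof.
exact: (hquad_orthogonal clif_anticomm rotate_rotate clif_form_linearl clif_form_sym clif_form_rotate).
Qed.

Lemma coframe_hquad_ee i k : coframe_hquad (ecov i) (ecov k) =
  (ext_mul (v 0 i) \o ext_mul (v 0 k))%VF + (ext_mul (v 1 i) \o ext_mul (v 1 k))%VF.
Proof. by rewrite coframe_hquad_orthogonal ?clif_form_ee // !rotate_ecov !clif_cov. Qed.

Lemma coframe_hquad_ff i k : coframe_hquad (fvec i) (fvec k) =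
  (contraction (v 0 i *m G) \o contraction (v 0 k *m G))%VF
  + (contraction (v 1 i *m G) \o contraction (v 1 k *m G))%VF.
Proof. by rewrite coframe_hquad_orthogonal ?clif_form_ff // !rotate_fvec !clif_vec. Qed.

Lemma coframe_hquad_eje i : coframe_hquad (ecov i) (rotate (ecov i))
  = 2 *: (ext_mul (v 0 i) \o ext_mul (v 1 i))%VF.
Proof.
rewrite /coframe_hquad (hquad_rotated clif_linear rotate_rotate).
by rewrite (quad_orthogonal clif_anticomm) ?clif_form_eje // rotate_ecov !clif_cov.
Qed.

Lemma coframe_hquad_fjf i : coframe_hquad (rotate (fvec i)) (fvec i)
  = 2 *: (contraction (v 1 i *m G) \o contraction (v 0 i *m G))%VF.
Proof.
rewrite /coframe_hquad hquadC (hquad_rotated clif_linear rotate_rotate).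
rewrite -scalerN -quadC (quad_orthogonal clif_anticomm).
  by rewrite rotate_fvec !clif_vec.
by rewrite clif_form_sym clif_form_fjf.
Qed.

Lemma rotation_op_sum : rotation_op = \sum_i coframe_hquad (rotate (ecov i)) (fvec i).
Proof.
apply: eq_bigr => i _; rewrite coframe_hquad_orthogonal; last first.
  by rewrite clif_form_rotate clif_form_ejf oppr0.
rewrite rotate_rotate rotate_ecov rotate_fvec (linear_mapN clif_linear).
by rewrite !clif_cov !clif_vec comp_lfunNl.
Qed.

Lemma lin_closed_derivation : lin_closed (@derivation R n).
Proof.
split=> [phi psi|c D E dD dE phi psi].
  by rewrite !zero_lfunE wedge0l linear0 addr0.
rewrite !add_lfunE !scale_lfunE dD dE wedgeDl wedgeZl.
rewrite (linear_mapD (wedge_linear phi)) (linear_mapZ (wedge_linear phi)).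
by rewrite scalerDr addrACA.
Qed.

Lemma lin_closed_degree0 : lin_closed (@degree0 R n).
Proof.
split=> [k phi _ S|c D E dD dE k phi hphi S]; first by rewrite zero_lfunE ffunE eqxx.
rewrite add_lfunE scale_lfunE !ffunE => nz.
have [ES|/(dE k phi hphi) //] := eqVneq (E phi S) 0.
apply: (dD k phi hphi); apply: contraNneq nz => ->.
by rewrite ES scaler0 addr0.
Qed.

(** A coefficient of the image at S involves only coefficients at sets obtained
    from S by exchanging one element. *)
Lemma degree0_ext_mul_contraction a t :
  degree0 (ext_mul a \o contraction t : 'End(ext R n))%VF.
Proof.
move=> k phi hphi S; rewrite comp_lfunE ext_mulE => nz.
apply/eqP; apply: contraNT nz => Sk; rewrite big1 // => i iS.
rewrite contractionE big1 ?mulr0 // => j jS.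
suff -> : phi (j |: S :\ i)%SET = 0 by rewrite mulr0.
apply/eqP; apply: contraNT Sk => /hphi <-.
by rewrite cardsU1 jS (cardsD1 i S) iS.
Qed.

Lemma wedge1r (phi : ext R n) : wedge phi (ext_basis R set0) = phi.
Proof.
apply/ffunP => S; rewrite ffunE (bigD1 S) ?subxx //= big1 ?addr0.
  rewrite ffunE setDv eqxx mulr1 ext_signE big1 ?mul1r // => s _.
  by rewrite big_set0.
move=> T /andP[TS TnS]; rewrite ffunE (_ : _ == _ = false) ?mulr0 //.
by apply/negbTE; apply: contra TnS; rewrite setD_eq0 eqEsubset TS.
Qed.

Lemma derivation1 (D : 'End(ext R n)) : derivation D -> D (ext_basis R set0) = 0.
Proof.
move=> dD; have := dD (ext_basis R set0) (ext_basis R set0).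
rewrite wedge1r wedge1r wedge1l => /eqP.
by rewrite -[X in X == _]addr0 (inj_eq (addrI _)) eq_sym => /eqP.
Qed.

(** A derivation kills the unit form, so it is determined on all products of
    one-forms. *)
Lemma derivation_unique (D E : 'End(ext R n)) : derivation D -> derivation E ->
  (forall u, D (form1 u) = E (form1 u)) -> D = E.
Proof.
move=> dD dE DE; apply/lfunP; apply: ext_ind => [|c phi psi hphi hpsi|u phi h].
- by rewrite !derivation1.
- by rewrite !linearD !linearZ /= hphi hpsi.
- by rewrite wedgeLE dD dE DE h.
Qed.

Lemma rotation_op_form1 u : rotation_op (form1 u) = form1 (rot_cov u).
Proof.
have form1E (w : 'rV[R]_n) : form1 w = ext_mul w (ext_basis R set0).
  by rewrite wedgeLE wedge1r.
have J1 : rotation_op (ext_basis R set0) = 0.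
  rewrite sum_lfunE big1 // => i _.
  by rewrite add_lfunE opp_lfunE !comp_lfunE !contraction1 !linear0 addr0.
have := congr1 (fun D : 'End(ext R n) => D (ext_basis R set0)) (rotation_op_clif (0, u)).
rewrite lie_bracketE J1 linear0 subr0 /rotate /= (linear_map0 rot_vec_linear).
by rewrite !clif_cov -!form1E.
Qed.

Lemma rotation_op_derivation : derivation rotation_op.
Proof.
apply: (lin_closed_sum lin_closed_derivation) => i.
apply: (lin_closedD lin_closed_derivation); first exact: derivation_ext_mul_contraction.
apply: (lin_closedN lin_closed_derivation); exact: derivation_ext_mul_contraction.
Qed.

Lemma rotation_op_degree0 : degree0 rotation_op.
Proof.
apply: (lin_closed_sum lin_closed_degree0) => i.
apply: (lin_closedD lin_closed_degree0); first exact: degree0_ext_mul_contraction.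
apply: (lin_closedN lin_closed_degree0); exact: degree0_ext_mul_contraction.
Qed.

Lemma opJ_rotation_op : opJ v = rotation_op.
Proof.
have rotation_opP j : rotation_op (form1 (v 0 j)) = form1 (v 1 j) /\ rotation_op (form1 (v 1 j)) = - form1 (v 0 j).
  by rewrite !rotation_op_form1 rot_cov0 rot_cov1 (linear_mapN (@form1_linear R n)).
rewrite /opJ; case: xgetP => [D _ [dD _ DP]|/(_ rotation_op)[]]; last first.
  by split; [exact: rotation_op_derivation|exact: rotation_op_degree0|].
apply: derivation_unique => //; first exact: rotation_op_derivation.
elim/coframe_span => [c u w hu hw|].
  by rewrite form1_linear !linearD !linearZ /= hu hw.
by elim/ord2_ind => j; [rewrite (DP j).1 (rotation_opP j).1|rewrite (DP j).2 (rotation_opP j).2].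
Qed.

Lemma sum_ord2 (A : zmodType) (F : 'I_2 -> A) : \sum_i F i = F 0 + F 1.
Proof.
by rewrite !big_ord_recl big_ord0 addr0; congr (F _ + F _); exact: val_inj.
Qed.

(** Each of the three two-forms is the sum of a product of covectors from two of the
    planes and of the image of this product under the rotation. *)
Lemma wedgeL_form2 j k : wedgeL (form2 (\sum_i wedge2 (v i j) (v i k)))
  = coframe_hquad (ecov j) (ecov k).
Proof.
rewrite sum_ord2 (linear_mapD (@form2_linear R n)) (linear_mapD (@wedgeL_linear R n)).
by rewrite -!wedge_form1 !wedgeL_wedge_form1 coframe_hquad_ee.
Qed.

(** Taking adjoints exchanges wedging and contraction and reverses products. *)
Lemma ext_dot_coframe_hquad j k phi psi :
  ext_dot g (coframe_hquad (ecov j) (ecov k) phi) psi = ext_dot g phi (coframe_hquad (fvec k) (fvec j) psi).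
Proof.
rewrite coframe_hquad_ee coframe_hquad_ff !add_lfunE !comp_lfunE.
rewrite (linear_mapD (ext_dot_linearl g psi)) (linear_mapD (ext_dot_linearr g phi)).
by rewrite !ext_dot_ext_mul.
Qed.

Lemma adjointN (D E : 'End(ext R n)) :
  (forall phi psi, ext_dot g (D phi) psi = ext_dot g phi (E psi)) ->
  adjoint g (- D) = - E.
Proof.
move=> DE; apply: (adjoint_unique metric_unit) => phi psi; rewrite !opp_lfunE.
rewrite (linear_mapN (ext_dot_linearl g psi)) (linear_mapN (ext_dot_linearr g phi)).
by rewrite DE.
Qed.

End Coframe.

(** * The operators of the manifold *)

Local Open Scope classical_set_scope.
Local Open Scope ring_scope.
Local Open Scope complex_scope.

Theorem corollary5p12 (R : realType) (n : nat) (X : topologicalType)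
    (M : smooth_manifold R n X) (o : orientation M) (W : wsd_structure M 2)
    (W_nondegenerate : wsd_nondegenerate W)
    (p : X) (a : chart M) (p_dom : chart_dom a p)
    (v : 'I_2 -> 'I_3 -> 'rV[R]_n) (v_adapted : oriented_adapted_coframe W o a p v) :
  let LC := wsd_lieC W a p v in
  let J := [set c *: cplx (opJ v) | c in [set: R[i]]] in
  LC `&` J = [set 0] /\
  [set D + E | D in LC & E in J] = quadratic_invariants v.
Proof.
have [adapted _] := v_adapted.
have [g_sym g_pos] := metricP W p_dom.
set g := metric W a p in g_sym g_pos.
have [_ _ _ [w1E w2E wDE]] := adapted.
rewrite big_ord0 addr0 in wDE.
have g_unit := metric_unit g_pos.
pose ec := ecov v; pose fv := fvec g v; pose rot := rotate g v.
pose H := coframe_hquad g v.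
have HC x y : H y x = - H x y by exact: hquadC.
(* every generator is a multiple of some H *)
have L0 : opL W a p 0 = H (ec 1) (ec 2).
  by rewrite /opL /= wDE; exact: (wedgeL_form2 g_sym g_pos adapted).
have L1 : opL W a p 1 = - H (ec 0) (ec 2).
  rewrite /opL /= w2E (linear_mapN (@wedgeL_linear R n)); congr (- _).
  exact: (wedgeL_form2 g_sym g_pos adapted).
have L2 : opL W a p 2 = H (ec 0) (ec 1).
  by rewrite /opL /= w1E; exact: (wedgeL_form2 g_sym g_pos adapted).
have HV k : opV v k = 2^-1 *: H (ec k) (rot (ec k)).
  rewrite /H /rot /ec (coframe_hquad_eje g_sym g_pos adapted) scalerA mulVf ?pnatr_eq0 // scale1r.
  exact: wedgeL_wedge_form1.
have adj j k := ext_dot_coframe_hquad g_sym g_pos adapted j k.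
have La0 : opLambda W a p 0 = H (fv 2) (fv 1).
  by rewrite /opLambda L0; apply: (adjoint_unique g_unit) => phi psi; exact: adj.
have La1 : opLambda W a p 1 = - H (fv 2) (fv 0).
  by rewrite /opLambda L1; apply: (adjointN g_pos) => phi psi; exact: adj.
have La2 : opLambda W a p 2 = H (fv 1) (fv 0).
  by rewrite /opLambda L2; apply: (adjoint_unique g_unit) => phi psi; exact: adj.
have HA k : opA W a p v k = - (2^-1 *: H (fv k) (rot (fv k))).
  rewrite -scalerN -HC /H /rot /fv (coframe_hquad_fjf g_sym g_pos adapted) scalerA.
  rewrite mulVf ?pnatr_eq0 // scale1r /opA /opV wedgeL_wedge_form1.
  exact: (adjoint_ext_mul2 g_unit).
pose G := (range (opL W a p) `|` range (opV v) `|` range (opLambda W a p)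
  `|` range (opA W a p v))%classic.
have cG : lie_closed (lie_generated G) by exact: lie_generated_closed.
have GL k : lie_generated G (opL W a p k).
  by apply: lie_generated_gen; do 3!left; exists k.
have GV k : lie_generated G (opV v k).
  by apply: lie_generated_gen; do 2!left; right; exists k.
have GLa k : lie_generated G (opLambda W a p k).
  by apply: lie_generated_gen; left; right; exists k.
have GA k : lie_generated G (opA W a p v k).
  by apply: lie_generated_gen; right; exists k.
have GN D : lie_generated G (- D) -> lie_generated G D.
  by move=> h; rewrite -[D]opprK; apply: (lin_closedN cG.1).
have half_neq0 : 2^-1 != 0 :> R by rewrite invr_eq0 pnatr_eq0.
(* conversely, the generated algebra contains the four families of H *)
have GC x y : lie_generated G (H x y) -> lie_generated G (H y x).
  by move=> h; rewrite HC; apply: (lin_closedN cG.1).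
have G_ee i k : i != k -> lie_generated G (H (ec i) (ec k)).
  apply: (@ord3_pairs (fun i k => lie_generated G (H (ec i) (ec k)))).
  - by move=> {}i {}k; exact: GC.
  - rewrite -L2; exact: GL.
  - apply: GN; rewrite -L1; exact: GL.
  - rewrite -L0; exact: GL.
have G_ff i k : i != k -> lie_generated G (H (fv i) (fv k)).
  apply: (@ord3_pairs (fun i k => lie_generated G (H (fv i) (fv k)))).
  - by move=> {}i {}k; exact: GC.
  - apply: GC; rewrite -La2; exact: GLa.
  - apply: GC; apply: GN; rewrite -La1; exact: GLa.
  - apply: GC; rewrite -La0; exact: GLa.
have G_eje i : lie_generated G (H (ec i) (rot (ec i))).
  by apply: (lin_closedZV cG.1 half_neq0); rewrite -HV; exact: GV.
have G_fjf i : lie_generated G (H (fv i) (rot (fv i))).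
  by apply: (lin_closedZV cG.1 half_neq0); apply: GN; rewrite -HA; exact: GA.
(* the form b (j x, y) vanishes for the H(x, y) among the generators *)
have bee i k : clif_form (rot (ec i)) (ec k) = 0.
  by rewrite (clif_form_rotate g) (clif_form_eje g_sym adapted) oppr0.
have bff i k : clif_form (rot (fv i)) (fv k) = 0.
  by rewrite (clif_form_rotate g) (clif_form_fjf g_sym adapted) oppr0.
have b_rot_rot x y : clif_form x y = 0 -> clif_form (rot x) (rot y) = 0.
  by move=> bxy; rewrite (clif_form_rotate g) (rotate_rotate g_sym g_pos adapted)
    clif_form_sym (linear_mapN (clif_form_linearl _)) clif_form_sym bxy !oppr0.
have G_hquad D : G D -> exists c x y,
    D = c *: hquad (@clif R n) rot x y /\ clif_form (rot x) y = 0.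
  move=> [[[|]|]|] [k _ <-].
  - elim/ord3_ind: k.
    + exists 1, (ec 1), (ec 2); split; [rewrite scale1r; exact: L0|exact: bee].
    + exists (-1), (ec 0), (ec 2); split; [rewrite scaleN1r; exact: L1|exact: bee].
    + exists 1, (ec 0), (ec 1); split; [rewrite scale1r; exact: L2|exact: bee].
  - exists 2^-1, (ec k), (rot (ec k)); split; first exact: HV.
    apply: b_rot_rot; exact: clif_form_ee.
  - elim/ord3_ind: k.
    + exists 1, (fv 2), (fv 1); split; [rewrite scale1r; exact: La0|exact: bff].
    + exists (-1), (fv 2), (fv 0); split; [rewrite scaleN1r; exact: La1|exact: bff].
    + exists 1, (fv 1), (fv 0); split; [rewrite scale1r; exact: La2|exact: bff].
  - exists (- 2^-1), (fv k), (rot (fv k)); split; first by rewrite scaleNr; exact: HA.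
    apply: b_rot_rot; exact: clif_form_ff.
have JE : opJ v = rotation_op g v by apply: (opJ_rotation_op g_sym adapted).
have Q_quad : @clifford2 R n = quadratics (@clif R n).
  congr lin_span; apply/seteqP; split=> D.
    by move=> [t [u [t' [u' ->]]]]; exists (t, u), (t', u').
  by move=> [[t u] [[t' u'] ->]]; exists t, u, t', u'.
rewrite /wsd_lieC /wsd_lie /quadratic_invariants JE.
apply: complexified_decomposition.
- exact: cG.1.
- exact: lin_span_closed.
- move=> c; apply: (generated_multiple_of_J (@clif_linear R n) (@clif_anticomm R n) (j := rot)
    (rotation_op_clif g v) (rotate_rotate g_sym g_pos adapted) (@clif_form_linearl R n)
    (@clif_form_rotate R n g v) (@ext_tr_linear R n) (@ext_trC R n) (@ext_tr1_neq0 R n)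
    (isT : (2 < 3)%N) (clif_form_ef g_sym adapted) (rotation_op_sum g_sym g_pos adapted) G_hquad).
- move=> D; rewrite Q_quad.
  exact: (generated_plus_J (@clif_linear R n) (@clif_anticomm R n)
    (@rotate_linear R n g v) (rotation_op_clif g v) (rotate_rotate g_sym g_pos adapted)
    (@clif_form_linearl R n) (@clif_form_sym R n) (@clif_form_rotate R n g v)
    (@ext_tr_linear R n) (@ext_trC R n)
    (isT : (2 < 3)%N) (clif_form_ee v) (clif_form_ff g v) (clif_form_ef g_sym adapted)
    (clif_form_eje g_sym adapted) (clif_form_fjf g_sym adapted) (clif_form_ejf g_sym adapted)
    (clifford_span g_sym g_pos adapted) (rotation_op_sum g_sym g_pos adapted)
    G_hquad G_ee G_ff G_eje G_fjf).
Qed.
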